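(* Let $(a_n)_{n\ge 1}$ be a sequence of complex numbers such that the Dirichlet series $f(s)=\sum_{n=1}^\infty a_n n^{-s}$ has abscissa of absolute convergence equal to $0$. Write $a_n=|a_n|e^{i\theta_n}$ with $\theta_n\in\mathbb{R}$, and fix $M\in\mathbb{N}$, $M\ge 1$. Suppose that there exist $\rho>0$ and $\gamma>0$ such that, for all $l=0,1,2,\ldots$, $$(|a_{Ml+1}|,|a_{Ml+2}|,\ldots,|a_{Ml+M}|)\in B^{\rho}$$ and $$(\cos\theta_{Ml+1},\cos\theta_{Ml+2},\ldots,\cos\theta_{Ml+M})\in -\left(B^{\rho}\right)^{\sharp}+\gamma(1,1,\ldots,1).$$ Then $f$ does not have a holomorphic extension to a neighborhood of $s=0$.
   Context: The abscissa of absolute convergence of $\sum a_n n^{-s}$ is $\sigma_a=\inf\{\sigma\in\mathbb{R}:\sum a_n n^{-s}\text{ converges absolutely for all } s \text{ with } \Re s>\sigma\}$. When $\sigma_a=0$, $f$ is holomorphic on $\Omega_0=\{s\in\mathbb{C}:\Re s>0\}$; $f$ has a holomorphic extension to a neighborhood of $s=0$ if there are $r>0$ and a holomorphic function on $\Omega_0\cup\{|s|<r\}$ which agrees with $f$ on $\Omega_0$. For $\rho\in(0,\infty)$ and $M\ge1$, $$B^{\rho}=B^{\rho,M}=\{\beta=(\beta_1,\ldots,\beta_M)\in[0,\infty)^M:\ \beta_1\le\rho\beta_2\le\rho^2\beta_3\le\cdots\le\rho^{M-1}\beta_M\}.$$ For a convex cone $C\subset\mathbb{R}^M$, the polar cone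 is $C^{\sharp}=\{x\in\mathbb{R}^M: x\cdot c\le 0\ \ \forall c\in C\}$, where $x\cdot c$ is the standard inner product. For a set $S\subset\mathbb{R}^M$ and $v\in\mathbb{R}^M$, $-S=\{-x:x\in S\}$ and $S+v=\{x+v:x\in S\}$. *)

(* Defs.v *)
(* Complex analysis is that of Coquelicot, over the Stdlib reals [R]; vectors of
   R^M are MathComp row vectors ['rV[R]_M], with the ring and order structure
   which [Rstruct] puts on [R]. *)
Set Warnings "-notation-overridden,-ambiguous-paths".
From Stdlib Require Import Reals.
From Coquelicot Require Import Coquelicot.
From mathcomp Require Import all_boot all_order all_algebra.
From mathcomp Require Import classical_sets reals Rstruct.

Set Implicit Arguments.
Unset Strict Implicit.
Unset Printing Implicit Defensive.

Local Open Scope classical_set_scope.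
Local Open Scope ring_scope.

Section Cones.
Variables (K : realFieldType) (M : nat).
Implicit Types (S C : set 'rV[K]_M) (v x c : 'rV[K]_M).

(* The coordinate [b 0 i] is beta_(i+1), so the i-th term of the chain
   beta_1 <= rho beta_2 <= rho^2 beta_3 <= ... is [rho ^+ i * b 0 i]. *)
Definition Bcone (rho : K) : set 'rV[K]_M :=
  [set b : 'rV[K]_M | (forall i : 'I_M, 0 <= b 0 i) /\
           (forall i j : 'I_M, j = i.+1 :> nat ->
              rho ^+ i * b 0 i <= rho ^+ j * b 0 j)].

Definition dot x c : K := \sum_(i < M) x 0 i * c 0 i.

Definition polar_cone C : set 'rV[K]_M :=
  [set x : 'rV[K]_M | forall c, C c -> dot x c <= 0].

Definition set_opp S : set 'rV[K]_M := [set - x | x in S].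

Definition set_translate S v : set 'rV[K]_M := [set x + v | x in S].

End Cones.

Local Close Scope ring_scope.
Local Open Scope R_scope.

Definition Cexp (z : C) : C :=
  (exp (Re z) * cos (Im z), exp (Re z) * sin (Im z)).

(* [n^(-s)] for a positive integer [n]. *)
Definition nat_Cpow_opp (n : nat) (s : C) : C :=
  Cexp (- (s * RtoC (ln (INR n))))%C.

(* The coefficients are a_1, a_2, ...; the value [a 0] is never used. *)
Definition dirichlet_term (a : nat -> C) (s : C) (k : nat) : C :=
  (a k.+1 * nat_Cpow_opp k.+1 s)%C.

Definition abscissa_abs_conv (a : nat -> C) : Rbar :=
  Glb_Rbar (fun sigma : R => forall s : C, sigma < Re s ->
    ex_series (fun k => Cmod (dirichlet_term a s k))).

(* As for [RInt], the value is unspecified where the series diverges. *)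
Definition dirichlet_series (a : nat -> C) (s : C) : C :=
  @Coquelicot.Hierarchy.iota C_CompleteNormedModule
    (fun z => @is_series C_AbsRing C_NormedModule (dirichlet_term a s) z).

(* Meaningful for open [D]. *)
Definition holomorphic_on (D : C -> Prop) (f : C -> C) : Prop :=
  forall z : C, D z -> @ex_derive C_AbsRing C_NormedModule f z.

(* [f] matters only on the half-plane [0 < Re s]. *)
Definition has_holomorphic_extension_near_0 (f : C -> C) : Prop :=
  exists (r : R) (g : C -> C),
    0 < r /\
    holomorphic_on (fun s => 0 < Re s \/ Cmod s < r) g /\
    (forall s : C, 0 < Re s -> g s = f s).

(* Main.v *)
(* A Landau-type argument at the centre 1.  If f extends to |s| < r, it is holomorphic
   on a neighbourhood of the closed disc |s - 1| <= rho for every rho with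
   1 < rho < sqrt(1 + r^2), so its Taylor coefficients at 1, which are up to sign
   sum_n a_n (ln n)^k / (n k!), are O(rho^-k).  On each block the vector with
   entries |a_n| (ln n)^k lies in B^rho, since (ln n)^k is nondecreasing; polarity bounds
   its pairing with cos theta_n below by gamma sum |a_n| (ln n)^k, and for late blocks
   the weight 1/n is so close to constant that it costs only a factor 2.  Hence
   sum_n |a_n| (ln n)^k / (n k!) = O(rho^-k) up to finitely many n; multiplying by
   q^k with 1 < q < rho and summing over k gives sum_n |a_n| n^(q-1) < oo, which
   contradicts abscissa 0.

   The Cauchy estimate comes from Goursat's theorem applied to
   G(z) = g(1 + e^z) e^(-kz) on a rectangle of height 2 pi, where the horizontal
   sides cancel by periodicity. *)

Require Import Defs.
Set Warnings "-notation-overridden,-ambiguous-paths".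
From Stdlib Require Import Reals Lra Lia Classical_Prop.
From Coquelicot Require Import Coquelicot.
From mathcomp Require Import all_boot all_order all_algebra.
From mathcomp Require Import classical_sets reals Rstruct.

Local Open Scope R_scope.

(** * Green's theorem for closed forms on a rectangle *)

Lemma nested_intervals (a b : nat -> R) :
  (forall n, a n <= a n.+1) -> (forall n, b n.+1 <= b n) ->
  (forall n, a n <= b n) -> exists x, forall n, a n <= x <= b n.
Proof.
move=> ha hb hab.
have ham m k : a m <= a (m + k)%coq_nat.
  by elim: k => [|k ih]; rewrite ?Nat.add_0_r ?Nat.add_succ_r;
    [lra | move: (ha (m + k)%coq_nat); lra].
have hbm m k : b (m + k)%coq_nat <= b m.
  by elim: k => [|k ih]; rewrite ?Nat.add_0_r ?Nat.add_succ_r;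
    [lra | move: (hb (m + k)%coq_nat); lra].
have hle m n : a m <= b n.
  move: (ham m n) (hbm n m) (hab (m + n)%coq_nat).
  by rewrite (Nat.add_comm n m); lra.
have [x [hx1 hx2]] : {x | is_lub (fun t => exists n, t = a n) x}.
  apply: completeness.
    by exists (b 0%N) => _ [n ->].
  by exists (a 0%N), 0%N.
exists x => n; split.
  by apply: hx1; exists n.
by apply: hx2 => _ [m ->].
Qed.

Lemma half_pow_small (w d : R) : 0 < d -> exists n, w * (/ 2) ^ n < d.
Proof.
move=> hd.
have hw : 0 < Rabs w + 1 by move: (Rabs_pos w); lra.
have h0 : Rabs (/ 2) < 1 by rewrite Rabs_pos_eq; lra.
have [n hn] := pow_lt_1_zero (/ 2) h0 _ (Rdiv_lt_0_compat _ _ hd hw).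
exists n; move: (hn n (le_n n)).
have hp : 0 < (/ 2) ^ n by apply: pow_lt; lra.
rewrite Rabs_pos_eq; last lra.
move/(Rmult_lt_compat_l _ _ _ hw).
have -> : (Rabs w + 1) * (d / (Rabs w + 1)) = d by field; lra.
move: (Rle_abs w) => h1 h2; nra.
Qed.

Section Bisection.
Variables (E : R -> R -> R -> R -> R) (x0 x1 y0 y1 : R).
Hypotheses (hx : x0 <= x1) (hy : y0 <= y1).
Hypothesis E_split_x : forall a m b c d,
  x0 <= a <= m -> m <= b <= x1 -> y0 <= c <= d -> d <= y1 ->
  E a b c d = E a m c d + E m b c d.
Hypothesis E_split_y : forall a b c m d,
  x0 <= a <= b -> b <= x1 -> y0 <= c <= m -> m <= d <= y1 ->
  E a b c d = E a b c m + E a b m d.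
(** Every admissible rectangle contains the point [(x, y)]. The bound is little-o of the squared
    size, hence of [1 / 4 ^ n] along n bisections. *)
Hypothesis E_local : forall x y eps, x0 <= x <= x1 -> y0 <= y <= y1 -> 0 < eps ->
  exists del, 0 < del /\ forall a b c d,
    x0 <= a <= x -> x <= b <= x1 -> y0 <= c <= y -> y <= d <= y1 ->
    b - a < del -> d - c < del ->
    Rabs (E a b c d) <= eps * ((b - a) + (d - c)) ^ 2.

Let rect := (R * R * (R * R))%type.
Let size_E (q : rect) := Rabs (E q.1.1 q.1.2 q.2.1 q.2.2).
Let mid (u v : R) := (u + v) / 2.

(** The last quarter is returned untested: if the other three each carry less than a quarter of
    [size_E q], the triangle inequality leaves at least a quarter for it. *)
Let bisect (q : rect) : rect :=
  let m := mid q.1.1 q.1.2 in let k := mid q.2.1 q.2.2 in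
  let q1 := ((q.1.1, m), (q.2.1, k)) in let q2 := ((m, q.1.2), (q.2.1, k)) in
  let q3 := ((q.1.1, m), (k, q.2.2)) in let q4 := ((m, q.1.2), (k, q.2.2)) in
  if Rle_dec (size_E q / 4) (size_E q1) then q1 else
  if Rle_dec (size_E q / 4) (size_E q2) then q2 else
  if Rle_dec (size_E q / 4) (size_E q3) then q3 else q4.

Let inside (q : rect) :=
  (x0 <= q.1.1 <= q.1.2 /\ q.1.2 <= x1) /\ (y0 <= q.2.1 <= q.2.2 /\ q.2.2 <= y1).

Lemma bisectP (q : rect) : inside q ->
  [/\ inside (bisect q),
      q.1.1 <= (bisect q).1.1 /\ (bisect q).1.2 <= q.1.2,
      q.2.1 <= (bisect q).2.1 /\ (bisect q).2.2 <= q.2.2,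
      (bisect q).1.2 - (bisect q).1.1 = (q.1.2 - q.1.1) / 2 /\
      (bisect q).2.2 - (bisect q).2.1 = (q.2.2 - q.2.1) / 2 &
      size_E q / 4 <= size_E (bisect q)].
Proof.
case: q => [[a b] [c d]]; rewrite /inside /= => -[[hab hb] [hcd hd]].
have hm : a <= mid a b <= b by rewrite /mid; lra.
have hk : c <= mid c d <= d by rewrite /mid; lra.
have hE : size_E ((a, b), (c, d)) <=
   size_E ((a, mid a b), (c, mid c d)) + size_E ((mid a b, b), (c, mid c d)) +
   size_E ((a, mid a b), (mid c d, d)) + size_E ((mid a b, b), (mid c d, d)).
  rewrite /size_E /= (E_split_y a b c (mid c d) d); try lra.
  rewrite (E_split_x a (mid a b) b c (mid c d)); try lra.
  rewrite (E_split_x a (mid a b) b (mid c d) d); try lra.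
  set e1 := E _ _ _ _; set e2 := E _ _ _ _.
  set e3 := E _ _ _ _; set e4 := E _ _ _ _.
  move: (Rabs_triang (e1 + e2) (e3 + e4)) (Rabs_triang e1 e2) (Rabs_triang e3 e4).
  lra.
rewrite /bisect /=.
have em : mid a b = (a + b) / 2 by [].
have ek : mid c d = (c + d) / 2 by [].
by case: Rle_dec => h1 /=; [|case: Rle_dec => h2 /=; [|case: Rle_dec => h3 /=]];
  split=> //; lra.
Qed.

(* Goursat's bisection: the nested rectangles shrink to a point where [E_local]
   contradicts the lower bound [eta / 4 ^ n]. *)
Lemma rect_functional_zero : E x0 x1 y0 y1 = 0.
Proof.
apply: Rabs_eq_0.
have [//|hpos] : Rabs (E x0 x1 y0 y1) = 0 \/ 0 < Rabs (E x0 x1 y0 y1).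
  by move: (Rabs_pos (E x0 x1 y0 y1)); lra.
exfalso; set eta := Rabs (E x0 x1 y0 y1) in hpos.
pose q n := iter n bisect ((x0, x1), (y0, y1)).
have hin n : inside (q n).
  elim: n => [|n ih]; first by rewrite /inside /=; lra.
  by have [] := bisectP (q n) ih.
have hq n := bisectP (q n) (hin n).
have [x hx'] : exists x, forall n, (q n).1.1 <= x <= (q n).1.2.
  apply: nested_intervals => n.
  - by have [_ [h _] _ _ _] := hq n.
  - by have [_ [_ h] _ _ _] := hq n.
  - by move: (hin n) => [[h _] _]; lra.
have [y hy'] : exists y, forall n, (q n).2.1 <= y <= (q n).2.2.
  apply: nested_intervals => n.
  - by have [_ _ [h _] _ _] := hq n.
  - by have [_ _ [_ h] _ _] := hq n.
  - by move: (hin n) => [_ [h _]]; lra.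
have hwx n : (q n).1.2 - (q n).1.1 = (x1 - x0) * (/ 2) ^ n.
  elim: n => [|n ih] /=; first by lra.
  by have [_ _ _ [-> _] _] := hq n; rewrite ih; field.
have hwy n : (q n).2.2 - (q n).2.1 = (y1 - y0) * (/ 2) ^ n.
  elim: n => [|n ih] /=; first by lra.
  by have [_ _ _ [_ ->] _] := hq n; rewrite ih; field.
have hE n : eta * ((/ 2) ^ n) ^ 2 <= size_E (q n).
  elim: n => [|n ih]; first by rewrite /size_E /= -/eta; lra.
  by have [_ _ _ _] := hq n; rewrite -tech_pow_Rmult; rewrite /= in ih *; lra.
(* The summand 1 keeps [S] positive when the rectangle degenerates. With tolerance
   [eta / (2 * S ^ 2)] the local bound at stage n is at most half of the lower bound
   [eta / 4 ^ n]. *)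
set S := (x1 - x0) + (y1 - y0) + 1.
have hS : 1 <= S by rewrite /S; lra.
have heps : 0 < eta / (2 * S ^ 2) by apply: Rdiv_lt_0_compat => //; nra.
have [|| del [hdel hloc]] := E_local x y _ _ _ heps.
- by move: (hx' 0%N) => /=.
- by move: (hy' 0%N) => /=.
have [n hn] := half_pow_small S _ hdel.
have hp : 0 < (/ 2) ^ n by apply: pow_lt; lra.
have := hloc (q n).1.1 (q n).1.2 (q n).2.1 (q n).2.2.
have [[h1 h2] [h3 h4]] := hin n.
move: (hx' n) (hy' n) => h5 h6.
rewrite hwx hwy -Rmult_plus_distr_r.
set p := (/ 2) ^ n in hp hn hwx hwy hE *.
have hpx : (x1 - x0) * p < del by apply: Rle_lt_trans hn; apply: Rmult_le_compat_r; rewrite /S; lra.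
have hpy : (y1 - y0) * p < del by apply: Rle_lt_trans hn; apply: Rmult_le_compat_r; rewrite /S; lra.
move=> h7; have {h7} h7 := h7 ltac:(lra) ltac:(lra) ltac:(lra) ltac:(lra) hpx hpy.
have {}hE := hE n; rewrite -/p in hE.
have h8 := Rle_trans _ _ _ hE h7.
have hSS : (x1 - x0 + (y1 - y0)) ^ 2 <= S ^ 2 by apply: pow_incr; rewrite /S; lra.
have h9 : eta / (2 * S ^ 2) * ((x1 - x0 + (y1 - y0)) * p) ^ 2 <= eta / 2 * p ^ 2.
  have -> : eta / 2 * p ^ 2 = eta / (2 * S ^ 2) * (S ^ 2 * p ^ 2) by field; lra.
  rewrite Rpow_mult_distr; apply: Rmult_le_compat_l; first lra.
  by apply: Rmult_le_compat_r => //; nra.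
have : 0 < eta * p ^ 2 by apply: Rmult_lt_0_compat => //; nra.
lra.
Qed.

End Bisection.

Lemma differentiable_continuous_x (F : R -> R -> R) x y lx ly :
  differentiable_pt_lim F x y lx ly -> continuous (fun u => F u y) x.
Proof.
move=> h; apply/continuity_pt_filterlim.
have hd : differentiable_pt F x y by exists lx, ly.
move=> eps heps; have [d hdl] := differentiable_continuity_pt _ _ _ hd (mkposreal _ heps).
exists d; split; first exact: cond_pos.
move=> u [_ hu]; apply: hdl => //.
by rewrite Rminus_diag_eq // Rabs_R0; apply: cond_pos.
Qed.

Lemma differentiable_continuous_y (F : R -> R -> R) x y lx ly :
  differentiable_pt_lim F x y lx ly -> continuous (F x) y.
Proof.
move=> h; apply/continuity_pt_filterlim.
have hd : differentiable_pt F x y by exists lx, ly.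
move=> eps heps; have [d hdl] := differentiable_continuity_pt _ _ _ hd (mkposreal _ heps).
exists d; split; first exact: cond_pos.
move=> u [_ hu]; apply: hdl => //.
by rewrite Rminus_diag_eq // Rabs_R0; apply: cond_pos.
Qed.

Lemma RInt_near_const (h : R -> R) a b k m : a <= b -> ex_RInt h a b ->
  (forall t, a <= t <= b -> Rabs (h t - k) <= m) ->
  Rabs (RInt h a b - k * (b - a)) <= (b - a) * m.
Proof.
move=> hab hh hm.
have -> : RInt h a b - k * (b - a) = RInt (fun t => h t - k) a b.
  rewrite (RInt_minus h (fun=> k)) //; last exact: ex_RInt_const.
  by rewrite RInt_const /minus /plus /Hierarchy.opp /scal /= /mult /=; ring.
apply: abs_RInt_le_const => //.
by apply: (@ex_RInt_minus R_NormedModule) => //; apply: ex_RInt_const.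
Qed.

Section ClosedForm.
Variables (P Q : R -> R -> R) (x0 x1 y0 y1 : R).
Hypotheses (hx : x0 <= x1) (hy : y0 <= y1).
(** The shared number [d] is both the y-derivative of [P] and the x-derivative of [Q], so P dx + Q
    dy is closed. Derivatives are only required to exist pointwise; their continuity is not
    assumed. *)
Hypothesis closed : forall x y, x0 <= x <= x1 -> y0 <= y <= y1 -> exists px d qy,
  differentiable_pt_lim P x y px d /\ differentiable_pt_lim Q x y d qy.

Let ex_RInt_P a b y : x0 <= a <= b -> b <= x1 -> y0 <= y <= y1 ->
  ex_RInt (fun x => P x y) a b.
Proof.
move=> ha hb hy'; apply: (@ex_RInt_continuous R_CompleteNormedModule) => z.
rewrite Rmin_left ?Rmax_right; try lra; move=> hz.
have [|px [d [qy [hP _]]]] := closed z y _ hy'; first lra.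
exact: differentiable_continuous_x hP.
Qed.

Let ex_RInt_Q c d x : y0 <= c <= d -> d <= y1 -> x0 <= x <= x1 ->
  ex_RInt (Q x) c d.
Proof.
move=> ha hb hx'; apply: (@ex_RInt_continuous R_CompleteNormedModule) => z.
rewrite Rmin_left ?Rmax_right; try lra; move=> hz.
have [|px [d' [qy [_ hQ]]]] := closed x z hx' _; first lra.
exact: differentiable_continuous_y hQ.
Qed.

(** The counterclockwise boundary integral of P dx + Q dy, with opposite sides paired into one
    integrand. *)
Let E a b c d := RInt (fun x => P x c - P x d) a b + RInt (fun y => Q b y - Q a y) c d.

Let ex_RInt_PP a b c d : x0 <= a <= b -> b <= x1 -> y0 <= c <= d -> d <= y1 ->
  ex_RInt (fun x => P x c - P x d) a b.
Proof.
by move=> *; apply: (@ex_RInt_minus R_NormedModule); apply: ex_RInt_P; lra.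
Qed.

Let ex_RInt_QQ a b c d : x0 <= a <= b -> b <= x1 -> y0 <= c <= d -> d <= y1 ->
  ex_RInt (fun y => Q b y - Q a y) c d.
Proof.
by move=> *; apply: (@ex_RInt_minus R_NormedModule); apply: ex_RInt_Q; lra.
Qed.

Lemma closed_form_rect :
  RInt (fun x => P x y0 - P x y1) x0 x1 + RInt (fun y => Q x1 y - Q x0 y) y0 y1 = 0.
Proof.
apply: (rect_functional_zero E x0 x1 y0 y1) => //.
- move=> a m b c d h1 h2 h3 h4; rewrite /E.
  rewrite -(RInt_Chasles (fun x => P x c - P x d) a m b); try (apply: ex_RInt_PP; lra).
  rewrite (RInt_ext (fun y => Q b y - Q a y)
            (fun y => plus (Q m y - Q a y) (Q b y - Q m y))); last first.
    by move=> t _; rewrite /plus /=; ring.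
  rewrite (RInt_plus (fun y => Q m y - Q a y)); try (apply: ex_RInt_QQ; lra).
  by rewrite /plus /=; ring.
- move=> a b c m d h1 h2 h3 h4; rewrite /E.
  rewrite -(RInt_Chasles (fun y => Q b y - Q a y) c m d); try (apply: ex_RInt_QQ; lra).
  rewrite (RInt_ext (fun x => P x c - P x d)
            (fun x => plus (P x c - P x m) (P x m - P x d))); last first.
    by move=> t _; rewrite /plus /=; ring.
  rewrite (RInt_plus (fun x => P x c - P x m)); try (apply: ex_RInt_PP; lra).
  by rewrite /plus /=; ring.
- move=> x y eps hxx hyy heps.
  have [px [k [qy [hP hQ]]]] := closed x y hxx hyy.
  have heps2 : 0 < eps / 2 by lra.
  have [d1 h1] := hP (mkposreal _ heps2).
  have [d2 h2] := hQ (mkposreal _ heps2).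
  exists (Rmin d1 d2); split; first by apply: Rmin_pos; apply: cond_pos.
  move=> a b c d ha hb hc hd hw hh.
  have hw1 := Rlt_le_trans _ _ _ hw (Rmin_l _ _).
  have hw2 := Rlt_le_trans _ _ _ hw (Rmin_r _ _).
  have hh1 := Rlt_le_trans _ _ _ hh (Rmin_l _ _).
  have hh2 := Rlt_le_trans _ _ _ hh (Rmin_r _ _).
  set w := b - a in hw1 hw2 *; set h := d - c in hh1 hh2 *.
  have hin u v : a <= u <= b -> c <= v <= d ->
      Rmax (Rabs (u - x)) (Rabs (v - y)) <= w + h.
    by move=> *; apply: Rmax_lub; apply: Rabs_le; rewrite /w /h; lra.
  have bP u v : a <= u <= b -> c <= v <= d ->
      Rabs (P u v - P x y - (px * (u - x) + k * (v - y))) <= eps / 2 * (w + h).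
    move=> hu hv; apply: Rle_trans (h1 u v _ _) _.
    - by apply: Rle_lt_trans hw1; apply: Rabs_le; rewrite /w; lra.
    - by apply: Rle_lt_trans hh1; apply: Rabs_le; rewrite /h; lra.
    - by apply: Rmult_le_compat_l => /=; [lra | exact: hin].
  have bQ u v : a <= u <= b -> c <= v <= d ->
      Rabs (Q u v - Q x y - (k * (u - x) + qy * (v - y))) <= eps / 2 * (w + h).
    move=> hu hv; apply: Rle_trans (h2 u v _ _) _.
    - by apply: Rle_lt_trans hw2; apply: Rabs_le; rewrite /w; lra.
    - by apply: Rle_lt_trans hh2; apply: Rabs_le; rewrite /h; lra.
    - by apply: Rmult_le_compat_l => /=; [lra | exact: hin].
  (* To first order the horizontal sides contribute [- k * h * w] and the vertical ones [k * w * h],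
     which cancel because the cross derivative [k] is common. The errors add up to
     [eps * (w + h) ^ 2]. *)
  have b1 : Rabs (RInt (fun x => P x c - P x d) a b - (- (k * h)) * w) <= w * (eps * (w + h)).
    apply: RInt_near_const; [lra | apply: ex_RInt_PP; lra | move=> t ht].
    move: (bP t c ht ltac:(lra)) (bP t d ht ltac:(lra)).
    by rewrite /h => /Rabs_le_between b1 /Rabs_le_between b2; apply/Rabs_le_between; lra.
  have b2 : Rabs (RInt (fun y => Q b y - Q a y) c d - (k * w) * h) <= h * (eps * (w + h)).
    apply: RInt_near_const; [lra | apply: ex_RInt_QQ; lra | move=> t ht].
    move: (bQ a t ltac:(lra) ht) (bQ b t ltac:(lra) ht).
    by rewrite /w => /Rabs_le_between b2 /Rabs_le_between b3; apply/Rabs_le_between; lra.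
  rewrite /E; move: b1 b2 => /Rabs_le_between b1 /Rabs_le_between b2.
  apply/Rabs_le_between; nra.
Qed.

End ClosedForm.

(** * Complex differentiability *)

(** The uniform structure whose balls are the discs of [Cmod], as opposed to the product structure
    on pairs of reals. *)
Definition Cspace := AbsRing_UniformSpace C_AbsRing.

(* Caratheodory's form of complex differentiability, which makes the product and
   chain rules statements about continuity only. *)
Definition cdiff (f : C -> C) (z : C) := exists phi : C -> C,
  @continuous Cspace Cspace phi z /\ forall w, f w = (f z + phi w * (w - z))%C.

Lemma continuous_CP (f : C -> C) (z : C) : @continuous Cspace Cspace f z <->
  forall eps, 0 < eps -> exists d, 0 < d /\
    forall w, Cmod (w - z)%C < d -> Cmod (f w - f z)%C < eps.
Proof.
split.
- move=> h eps heps.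
  have [d hd] := proj1 (@filterlim_locally _ Cspace _ _ f (f z)) h (mkposreal _ heps).
  by exists d; split; [exact: cond_pos | move=> w hw; apply: hd].
- move=> h; apply/filterlim_locally => eps.
  have [d [hd hw]] := h eps (cond_pos eps).
  by exists (mkposreal _ hd) => w hwz; apply: hw.
Qed.

Lemma cdiff_continuous f z : cdiff f z -> @continuous Cspace Cspace f z.
Proof.
move=> [phi [hphi hf]].
apply: (@continuous_ext Cspace Cspace (fun w => plus (f z) (mult (phi w) (minus w z)))).
  by move=> w; rewrite (hf w).
apply: (@continuous_plus Cspace C_AbsRing (AbsRing_NormedModule C_AbsRing)).
  exact: continuous_const.
apply: (@continuous_mult Cspace C_AbsRing) => //.
apply: (@continuous_minus Cspace C_AbsRing (AbsRing_NormedModule C_AbsRing)).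
  exact: continuous_id.
exact: continuous_const.
Qed.

Lemma cdiff_mult f g z : cdiff f z -> cdiff g z -> cdiff (fun w => f w * g w)%C z.
Proof.
move=> hf hg; have cf := cdiff_continuous _ _ hf.
move: hf hg => [phi [hphi hf]] [psi [hpsi hg]].
exists (fun w => f w * psi w + phi w * g z)%C; split; last first.
  by move=> w; rewrite (hf w) (hg w); ring.
apply: (@continuous_plus Cspace C_AbsRing (AbsRing_NormedModule C_AbsRing)).
  exact: (@continuous_mult Cspace C_AbsRing).
apply: (@continuous_mult Cspace C_AbsRing) => //.
exact: continuous_const.
Qed.

Lemma cdiff_comp f g z : cdiff g z -> cdiff f (g z) -> cdiff (fun w => f (g w)) z.
Proof.
move=> hg; have cg := cdiff_continuous _ _ hg.
move: hg => [psi [hpsi hg]] [phi [hphi hf]].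
exists (fun w => phi (g w) * psi w)%C; split; last first.
  by move=> w; rewrite (hf (g w)) (hg w); ring.
apply: (@continuous_mult Cspace C_AbsRing) => //.
exact: (@continuous_comp Cspace Cspace Cspace).
Qed.

Lemma cdiff_shift a z : cdiff (fun w => a + w)%C z.
Proof. by exists (fun=> 1%C); split; [exact: continuous_const | move=> w; ring]. Qed.

Lemma cdiff_scal b z : cdiff (fun w => b * w)%C z.
Proof. by exists (fun=> b); split; [exact: continuous_const | move=> w; ring]. Qed.

Lemma Cminus_neq_0 (w z : C) : w <> z -> (w - z)%C <> 0%C.
Proof.
by move=> h e; apply: h; have -> : w = (z + (w - z))%C by [ring]; rewrite e; ring.
Qed.

Lemma cdiff_eps (f : C -> C) (z l : C) :
  (forall eps, 0 < eps -> exists d, 0 < d /\ forall w, Cmod (w - z)%C < d ->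
     Cmod (f w - f z - l * (w - z))%C <= eps * Cmod (w - z)%C) -> cdiff f z.
Proof.
(* The difference quotient, completed at [z] by the derivative [l]. *)
pose phi w := (if Ceq_dec w z then l else (f w - f z) / (w - z))%C.
move=> h; exists phi; split; last first.
  move=> w; rewrite /phi; case: Ceq_dec => [e|hw] /=; first by rewrite e; ring.
  by field; apply: Cminus_neq_0.
apply/continuous_CP => eps heps.
have [d [hd hw]] := h (eps / 2) ltac:(lra).
exists d; split=> // w hwd /=.
have -> : phi z = l by rewrite /phi; case: Ceq_dec.
rewrite /phi; case: Ceq_dec => [e|hwz].
  have -> : (l - l = 0)%C by ring.
  by rewrite Cmod_0.
have hwz' := Cminus_neq_0 _ _ hwz.
have hpos : 0 < Cmod (w - z)%C by apply/Cmod_gt_0.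
have -> : ((f w - f z) / (w - z) - l = (f w - f z - l * (w - z)) / (w - z))%C by field.
rewrite Cmod_div //.
apply: Rle_lt_trans (_ : eps / 2 < eps); last lra.
by apply/Rle_div_l => //; apply: hw.
Qed.

Lemma ex_derive_cdiff (f : C -> C) z :
  @ex_derive C_AbsRing C_NormedModule f z -> cdiff f z.
Proof.
move=> [l [_ h]]; apply: (cdiff_eps f z l) => eps heps.
have hlim : is_filter_lim (@locally (AbsRing_NormedModule C_AbsRing) z) z by [].
have [d hd] := h z hlim (mkposreal _ heps).
exists d; split; first exact: cond_pos.
move=> w hw; have := hd w hw.
rewrite /norm /minus /plus /scal /Hierarchy.opp /= /mult /=.
by rewrite (Cmult_comm (w + - z) l).
Qed.

Lemma Rmax_Cmod_minus (w z : C) :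
  Rmax (Rabs (w.1 - z.1)) (Rabs (w.2 - z.2)) <= Cmod (w - z)%C.
Proof. exact: (Rmax_Cmod (w - z)%C). Qed.

Lemma Cmod_le_Rmax (w : C) : Cmod w <= 2 * Rmax (Rabs w.1) (Rabs w.2).
Proof.
apply: Rle_trans (Cmod_2Rmax w) _; apply: Rmult_le_compat_r.
  by apply: Rle_trans (Rmax_l _ _); apply: Rabs_pos.
rewrite -[X in _ <= X]sqrt_square; last lra.
by apply: sqrt_le_1_alt; lra.
Qed.

Lemma cauchy_riemann_cdiff (U V : R -> R -> R) x y p q :
  differentiable_pt_lim U x y p q -> differentiable_pt_lim V x y (- q) p ->
  cdiff (fun w => (U w.1 w.2, V w.1 w.2)) (x, y).
Proof.
(* The complex derivative is U_x - i U_y. The two real errors are taken at [eps / 2] since [Cmod] is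
   at most twice the larger component. *)
move=> hU hV; apply: (cdiff_eps _ _ (p, - q)) => eps heps.
have heps2 : 0 < eps / 2 by lra.
have [d1 h1] := hU (mkposreal _ heps2).
have [d2 h2] := hV (mkposreal _ heps2).
exists (Rmin d1 d2); split; first by apply: Rmin_pos; apply: cond_pos.
move=> w hw; have hm := Rmax_Cmod_minus w (x, y).
have hmx := Rle_trans _ _ _ (Rmax_l _ _) hm.
have hmy := Rle_trans _ _ _ (Rmax_r _ _) hm.
have hd1 := Rlt_le_trans _ _ _ hw (Rmin_l _ _).
have hd2 := Rlt_le_trans _ _ _ hw (Rmin_r _ _).
have b1 := h1 w.1 w.2 (Rle_lt_trans _ _ _ hmx hd1) (Rle_lt_trans _ _ _ hmy hd1).
have b2 := h2 w.1 w.2 (Rle_lt_trans _ _ _ hmx hd2) (Rle_lt_trans _ _ _ hmy hd2).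
apply: Rle_trans (Cmod_le_Rmax _) _.
suff : Rmax (Rabs (U w.1 w.2 - U x y - (p * (w.1 - x) + q * (w.2 - y))))
   (Rabs (V w.1 w.2 - V x y - (- q * (w.1 - x) + p * (w.2 - y)))) <=
   eps / 2 * Cmod (w - (x, y))%C.
  move=> h; have {}h := Rmult_le_compat_l 2 _ _ ltac:(lra) h.
  apply: Rle_trans (_ : _ <= 2 * (eps / 2 * Cmod (w - (x, y))%C)) _; last lra.
  apply: Rle_trans h; apply: Req_le; congr (_ * Rmax (Rabs _) (Rabs _)) => /=; ring.
by apply: Rmax_lub; [apply: Rle_trans b1 _ | apply: Rle_trans b2 _];
  apply: Rmult_le_compat_l => /=; [lra | exact: hm | lra | exact: hm].
Qed.

Lemma differentiable_pt_lim_snd x y : differentiable_pt_lim (fun _ v => v) x y 0 1.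
Proof.
move=> eps; exists (mkposreal 1 Rlt_0_1) => u v _ _.
have -> : v - y - (0 * (u - x) + 1 * (v - y)) = 0 by ring.
rewrite Rabs_R0; apply: Rmult_le_pos; first by apply: Rlt_le; apply: cond_pos.
by apply: Rle_trans (Rmax_l _ _); apply: Rabs_pos.
Qed.

Lemma differentiable_pt_lim_mult x y : differentiable_pt_lim Rmult x y y x.
Proof.
move=> eps; exists eps => u v hu hv.
have -> : u * v - x * y - (y * (u - x) + x * (v - y)) = (u - x) * (v - y) by ring.
rewrite Rabs_mult; apply: Rmult_le_compat; try exact: Rabs_pos; last exact: Rmax_r.
exact: Rlt_le.
Qed.

Lemma differentiable_pt_lim_prod (f g : R -> R) x y l m :
  derivable_pt_lim f x l -> derivable_pt_lim g y m ->
  differentiable_pt_lim (fun u v => f u * g v) x y (l * g y) (f x * m).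
Proof.
move=> hf hg.
(* The factor [g v] is treated as a function of the first variable precomposed with the map sending
   (u, v) to (v, v). *)
have := differentiable_pt_lim_comp Rmult (fun u _ => f u) (fun _ v => g v) x y _ _ _ _ _ _
  (differentiable_pt_lim_mult (f x) (g y))
  (differentiable_pt_lim_proj1_0 f x y l hf)
  (differentiable_pt_lim_comp (fun u _ => g u) (fun _ v => v) (fun _ v => v) x y _ _ _ _ _ _
    (differentiable_pt_lim_proj1_0 g y y m hg)
    (differentiable_pt_lim_snd x y) (differentiable_pt_lim_snd x y)).
by congr (differentiable_pt_lim _ _ _ _ _); ring.
Qed.

Lemma cdiff_Cexp z : cdiff Cexp z.
Proof.
case: z => x y.
apply: (cauchy_riemann_cdiff (fun u v => exp u * cos v) (fun u v => exp u * sin v)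
  x y (exp x * cos y) (exp x * - sin y)).
  by apply: differentiable_pt_lim_prod; [apply: derivable_pt_lim_exp | apply: derivable_pt_lim_cos].
rewrite -Ropp_mult_distr_r Ropp_involutive.
by apply: differentiable_pt_lim_prod; [apply: derivable_pt_lim_exp | apply: derivable_pt_lim_sin].
Qed.

Lemma cdiff_cauchy_riemann f x y : cdiff f (x, y) -> exists p q,
  differentiable_pt_lim (fun u v => Re (f (u, v))) x y p q /\
  differentiable_pt_lim (fun u v => Im (f (u, v))) x y (- q) p.
Proof.
move=> [phi [/continuous_CP hphi hf]].
set l := phi (x, y).
have key (eps : posreal) : locally_2d (fun u v =>
   Cmod (f (u, v) - f (x, y) - l * ((u, v) - (x, y)))%C <=
     eps * Rmax (Rabs (u - x)) (Rabs (v - y))) x y.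
  have [d [hd hw]] := hphi (eps / 2) ltac:(move: (cond_pos eps); lra).
  have hd2 : 0 < d / 2 by lra.
  exists (mkposreal _ hd2) => u v /= hu hv.
  have hC := Cmod_le_Rmax ((u, v) - (x, y))%C.
  rewrite /= -!/(Rminus _ _) in hC.
  have hR : Rmax (Rabs (u - x)) (Rabs (v - y)) < d / 2 by apply: Rmax_lub_lt.
  have hR0 : 0 <= Rmax (Rabs (u - x)) (Rabs (v - y)).
    by apply: Rle_trans (Rmax_l _ _); apply: Rabs_pos.
  have := hw (u, v) ltac:(lra).
  rewrite (hf (u, v)) -/l => hphi'.
  have -> : (f (x, y) + phi (u, v) * ((u, v) - (x, y)) - f (x, y) -
     l * ((u, v) - (x, y)) = (phi (u, v) - l) * ((u, v) - (x, y)))%C by ring.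
  rewrite Cmod_mult.
  apply: Rle_trans (_ : _ <= eps / 2 * (2 * Rmax (Rabs (u - x)) (Rabs (v - y)))) _; last lra.
  by apply: Rmult_le_compat => //; try exact: Cmod_ge_0; apply: Rlt_le.
exists (Re l), (- Im l); split=> eps; have [d hd] := key eps; exists d => u v hu hv;
  apply: Rle_trans (hd u v hu hv).
- apply: Rle_trans (re_le_Cmod _); apply: Req_le; congr Rabs.
  by rewrite /Re /Im /=; ring.
- apply: Rle_trans (Rle_trans _ _ _ (Rmax_r _ _) (Rmax_Cmod _)); apply: Req_le; congr Rabs.
  by rewrite /Re /Im /=; ring.
Qed.

Lemma cdiff_continuous_vertical f x y : cdiff f (x, y) ->
  continuous (fun t => Re (f (x, t))) y.
Proof.
move=> /cdiff_cauchy_riemann [p [q [h _]]].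
exact: (differentiable_continuous_y _ _ _ _ _ h).
Qed.

(** * Integrals over a vertical period *)

(** The form Im (G dz) = Im G dx + Re G dy is closed by the Cauchy-Riemann equations. Over a
    rectangle of height 2 pi the horizontal sides cancel by periodicity, so the vertical sides carry
    equal integrals. *)
Lemma periodic_strip_integral (G : C -> C) x0 x1 : x0 <= x1 ->
  (forall z, x0 <= Re z <= x1 -> cdiff G z) ->
  (forall x, G (x, 2 * PI) = G (x, 0)) ->
  RInt (fun y => Re (G (x1, y))) 0 (2 * PI) = RInt (fun y => Re (G (x0, y))) 0 (2 * PI).
Proof.
move=> hx hG hper.
have hpi : 0 <= 2 * PI by move: PI_RGT_0; lra.
have := closed_form_rect (fun u v => Im (G (u, v))) (fun u v => Re (G (u, v)))
  x0 x1 0 (2 * PI) hx hpi.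
have ex x : x0 <= x <= x1 -> ex_RInt (fun y => Re (G (x, y))) 0 (2 * PI).
  move=> hxx; apply: (@ex_RInt_continuous R_CompleteNormedModule) => y _.
  exact: cdiff_continuous_vertical (hG (x, y) hxx).
rewrite (RInt_ext (fun x => Im (G (x, 0)) - Im (G (x, 2 * PI))) (fun=> 0)); last first.
  by move=> x _; rewrite hper; apply: Rminus_diag_eq.
rewrite RInt_const /scal /= /mult /=.
have -> : RInt (fun y => Re (G (x1, y)) - Re (G (x0, y))) 0 (2 * PI) =
    RInt (fun y => Re (G (x1, y))) 0 (2 * PI) - RInt (fun y => Re (G (x0, y))) 0 (2 * PI).
  by apply: (@RInt_minus R_CompleteNormedModule); apply: ex; lra.
move=> h; suff : forall a b, (x1 - x0) * 0 + (a - b) = 0 -> a = b.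
  apply; apply: h => x y hxx _.
  have [p [q [h1 h2]]] := cdiff_cauchy_riemann _ _ _ (hG (x, y) hxx).
  by exists (- q), p, q.
by move=> a b; lra.
Qed.

(** * Fourier integrals of the exponential *)

Lemma Cmod_Cexp z : Cmod (Cexp z) = exp (Re z).
Proof.
rewrite /Cexp /Cmod /=.
have -> : exp (Re z) * cos (Im z) * (exp (Re z) * cos (Im z) * 1) +
   exp (Re z) * sin (Im z) * (exp (Re z) * sin (Im z) * 1) =
   exp (Re z) * exp (Re z) * (Rsqr (sin (Im z)) + Rsqr (cos (Im z))) by rewrite /Rsqr; ring.
by rewrite sin2_cos2 Rmult_1_r sqrt_square //; apply: Rlt_le; apply: exp_pos.
Qed.

(** In the coordinate z with u = e^z, the circle of radius e^x becomes a vertical segment at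
    abscissa x, and its integral does not depend on x. Far to the left the circle shrinks to 0,
    where continuity of [h] gives the value. *)
Lemma mean_value_Re (h : C -> C) r : 0 < r -> (forall z, cdiff h z) ->
  RInt (fun y => Re (h (r * cos y, r * sin y))) 0 (2 * PI) = 2 * PI * Re (h (RtoC 0)).
Proof.
move=> hr hh; have hpi := PI_RGT_0.
pose G z := h (Cexp z).
have hG z : cdiff G z by apply: cdiff_comp; [exact: cdiff_Cexp | exact: hh].
have hper x : G (x, 2 * PI) = G (x, 0).
  by rewrite /G /Cexp /= cos_2PI sin_2PI cos_0 sin_0.
have -> : RInt (fun y => Re (h (r * cos y, r * sin y))) 0 (2 * PI) =
    RInt (fun y => Re (G (ln r, y))) 0 (2 * PI).
  by apply: RInt_ext => y _; rewrite /G /Cexp /= exp_ln.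
apply: Rminus_diag_uniq; apply: Rabs_eq_0; apply: Rle_antisym; last exact: Rabs_pos.
apply: le_epsilon => eps heps; rewrite Rplus_0_l.
have heps' : 0 < eps / (2 * PI) by apply: Rdiv_lt_0_compat; lra.
have [d [hd hdh]] := proj1 (continuous_CP h 0%C) (cdiff_continuous _ _ (hh 0%C)) _ heps'.
(* The circle of radius e^x lies inside the disc where [h] is within [eps / (2 * PI)] of its value
   at 0, and [x] stays to the left of [ln r]. *)
pose x := Rmin (ln r) (ln (d / 2)).
have hxd : exp x <= d / 2.
  rewrite -[X in _ <= X]exp_ln; last lra.
  have [e|e] := Rle_lt_or_eq_dec _ _ (Rmin_r (ln r) (ln (d / 2))).
    by apply: Rlt_le; apply: exp_increasing.
  by rewrite /x e; lra.
rewrite (periodic_strip_integral G x (ln r)) //; last exact: Rmin_l.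
have := RInt_near_const (fun y => Re (G (x, y))) 0 (2 * PI) (Re (h (RtoC 0))) (eps / (2 * PI)).
rewrite Rminus_0_r.
have -> : 2 * PI * (eps / (2 * PI)) = eps by field; lra.
rewrite (Rmult_comm (Re _)); apply; first lra.
  apply: (@ex_RInt_continuous R_CompleteNormedModule) => y _.
  exact: cdiff_continuous_vertical (hG (x, y)).
move=> y _; apply: Rlt_le; apply: Rle_lt_trans (hdh (Cexp (x, y)) _).
  by rewrite /G; apply: Rle_trans (re_le_Cmod _); apply: Req_le; rewrite /Re /=.
have -> : (Cexp (x, y) - 0)%C = Cexp (x, y) by ring.
by rewrite Cmod_Cexp; move: hxd => /=; lra.
Qed.

Lemma cos_sub_period k x : cos (x - INR k * (2 * PI)) = cos x.
Proof. by rewrite -(cos_period _ k); congr cos; ring. Qed.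

Lemma sin_sub_period k x : sin (x - INR k * (2 * PI)) = sin x.
Proof. by rewrite -(sin_period _ k); congr sin; ring. Qed.

Lemma ex_RInt_exp_cos w k a b :
  ex_RInt (fun y => exp (w * cos y) * cos (w * sin y - k * y)) a b.
Proof.
apply: (@ex_RInt_continuous R_CompleteNormedModule) => y _.
by apply: (@ex_derive_continuous R_AbsRing R_NormedModule); auto_derive.
Qed.

Lemma ex_RInt_exp_sin w k a b :
  ex_RInt (fun y => exp (w * cos y) * sin (w * sin y - k * y)) a b.
Proof.
apply: (@ex_RInt_continuous R_CompleteNormedModule) => y _.
by apply: (@ex_derive_continuous R_AbsRing R_NormedModule); auto_derive.
Qed.

Lemma RInt_linear_comb (f g : R -> R) a b c d : ex_RInt f a b -> ex_RInt g a b ->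
  RInt (fun y => c * f y + d * g y) a b = c * RInt f a b + d * RInt g a b.
Proof.
move=> hf hg.
rewrite (RInt_plus (fun y => c * f y)); try exact: (@ex_RInt_scal R_NormedModule).
by rewrite !(RInt_scal _ _ _ _ ).
Qed.

Lemma is_RInt_derive_R (f df : R -> R) a b :
  (forall x, is_derive f x (df x)) -> (forall x, ex_derive df x) ->
  is_RInt df a b (f b - f a).
Proof.
move=> h1 h2; apply: (is_RInt_derive f) => x _ //.
exact: ex_derive_continuous.
Qed.

(** Integration over a period of the derivative of Im exp (w e^(iy) - i (k + 1) y); both boundary
    values are 0. *)
Lemma exp_cos_integral_S w k :
  INR k.+1 * RInt (fun y => exp (w * cos y) * cos (w * sin y - INR k.+1 * y)) 0 (2 * PI) =
  w * RInt (fun y => exp (w * cos y) * cos (w * sin y - INR k * y)) 0 (2 * PI).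
Proof.
have hF a : is_RInt (fun y => w * (exp (w * cos y) * cos (w * sin y - (a - 1) * y))
      + - a * (exp (w * cos y) * cos (w * sin y - a * y))) 0 (2 * PI)
    (exp (w * cos (2 * PI)) * sin (w * sin (2 * PI) - a * (2 * PI)) -
     exp (w * cos 0) * sin (w * sin 0 - a * 0)).
  apply: (is_RInt_derive_R (fun y => exp (w * cos y) * sin (w * sin y - a * y))) => y.
    auto_derive => //.
    have -> : w * sin y - (a - 1) * y = w * sin y - a * y + y by ring.
    by rewrite (cos_plus _ y) /Rminus; ring.
  by auto_derive.
have := is_RInt_unique _ _ _ _ (hF (INR k.+1)).
have -> : INR k.+1 - 1 = INR k by rewrite S_INR; ring.
rewrite RInt_linear_comb; try exact: ex_RInt_exp_cos.
rewrite sin_2PI sin_0 Rmult_0_r Rmult_0_r sin_sub_period Rminus_0_r sin_0.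
by lra.
Qed.

(** The same recurrence from the real part of exp (w e^(iy) - i (k + 1) y); here the two boundary
    values are both e^w and cancel. *)
Lemma exp_sin_integral_S w k :
  INR k.+1 * RInt (fun y => exp (w * cos y) * sin (w * sin y - INR k.+1 * y)) 0 (2 * PI) =
  w * RInt (fun y => exp (w * cos y) * sin (w * sin y - INR k * y)) 0 (2 * PI).
Proof.
have hF a : is_RInt (fun y => - w * (exp (w * cos y) * sin (w * sin y - (a - 1) * y))
      + a * (exp (w * cos y) * sin (w * sin y - a * y))) 0 (2 * PI)
    (exp (w * cos (2 * PI)) * cos (w * sin (2 * PI) - a * (2 * PI)) -
     exp (w * cos 0) * cos (w * sin 0 - a * 0)).
  apply: (is_RInt_derive_R (fun y => exp (w * cos y) * cos (w * sin y - a * y))) => y.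
    auto_derive => //.
    have -> : w * sin y - (a - 1) * y = w * sin y - a * y + y by ring.
    by rewrite (sin_plus _ y) /Rminus; ring.
  by auto_derive.
have := is_RInt_unique _ _ _ _ (hF (INR k.+1)).
have -> : INR k.+1 - 1 = INR k by rewrite S_INR; ring.
rewrite RInt_linear_comb; try exact: ex_RInt_exp_sin.
rewrite sin_2PI sin_0 Rmult_0_r Rmult_0_r cos_sub_period Rminus_0_r cos_2PI cos_0.
by lra.
Qed.

Lemma cdiff_Cexp_scal w z : cdiff (fun u => Cexp (RtoC w * u)%C) z.
Proof.
apply: (cdiff_comp Cexp (fun u => RtoC w * u)%C); first exact: cdiff_scal.
exact: cdiff_Cexp.
Qed.

(** This is the real part of Cauchy's formula for the k-th Taylor coefficient of u -> e^(wu) on the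
    unit circle. The mean value property gives k = 0, and the recurrence does the rest. *)
Lemma exp_cos_integral w k :
  RInt (fun y => exp (w * cos y) * cos (w * sin y - INR k * y)) 0 (2 * PI) =
  2 * PI * (w ^ k / INR k`!).
Proof.
elim: k => [|k ih].
  have := mean_value_Re (fun u => Cexp (RtoC w * u)%C) 1 Rlt_0_1 (cdiff_Cexp_scal w).
  have -> : (RtoC w * RtoC 0 = RtoC 0)%C by ring.
  rewrite /Cexp /= exp_0 cos_0 => h.
  have -> : 2 * PI * (1 / 1) = 2 * PI * (1 * 1) by field.
  rewrite -h; apply: RInt_ext => y _; congr (exp _ * cos _); ring.
have hk : INR k.+1 <> 0 by apply: not_0_INR.
apply: (Rmult_eq_reg_l (INR k.+1)) => //.
rewrite exp_cos_integral_S ih factS mulnE mult_INR -tech_pow_Rmult; field.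
by split=> //; apply: not_0_INR => e; move: (fact_gt0 k); rewrite e.
Qed.

Lemma exp_sin_integral w k :
  RInt (fun y => exp (w * cos y) * sin (w * sin y - INR k * y)) 0 (2 * PI) = 0.
Proof.
elim: k => [|k ih].
  (* Multiplication by -i turns the imaginary part into a real part, so the mean value property
     applies. *)
  have h z : cdiff (fun u => - Ci * Cexp (RtoC w * u))%C z.
    apply: (cdiff_comp (fun u => - Ci * u)%C); first exact: cdiff_Cexp_scal.
    exact: cdiff_scal.
  have := mean_value_Re _ 1 Rlt_0_1 h.
  have -> : (RtoC w * RtoC 0 = RtoC 0)%C by ring.
  rewrite /Cexp /= exp_0 cos_0 sin_0 => e.
  transitivity (2 * PI * (- 0 * (1 * 1) - - (1) * (1 * 0))); last by ring.
  rewrite -e; apply: RInt_ext => y _.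
  have -> : w * (1 * cos y) - 0 * (1 * sin y) = w * cos y by ring.
  have -> : w * (1 * sin y) + 0 * (1 * cos y) = w * sin y - 0 * y by ring.
  by apply: Rminus_diag_uniq; ring.
have hk : INR k.+1 <> 0 by apply: not_0_INR.
apply: (Rmult_eq_reg_l (INR k.+1)) => //.
by rewrite exp_sin_integral_S ih; ring.
Qed.

(** * Taylor coefficients of a Dirichlet series *)

(** The bound involves only the majorant [b]. Applied at every point of a circle it makes
    convergence uniform there, which permits integration term by term. *)
Lemma is_series_tail (u : nat -> C) (b : nat -> R) f beta N :
  @is_series C_AbsRing C_NormedModule u f -> (forall n, Cmod (u n) <= b n) ->
  is_series b beta ->
  Cmod (f - @sum_n C_AbelianMonoid u N)%C <= beta - @sum_n R_AbelianMonoid b N.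
Proof.
move=> hu hub hb.
have hM k : Cmod (@sum_n C_AbelianMonoid u (N + k)%coq_nat - @sum_n C_AbelianMonoid u N)%C <=
    @sum_n R_AbelianMonoid b (N + k)%coq_nat - @sum_n R_AbelianMonoid b N.
  elim: k => [|k ih].
    rewrite Nat.add_0_r Rminus_diag_eq //.
    have -> : (@sum_n C_AbelianMonoid u N - @sum_n C_AbelianMonoid u N = 0)%C by ring.
    by rewrite Cmod_0; lra.
  rewrite Nat.add_succ_r !sum_Sn /plus /=.
  set s := @sum_n C_AbelianMonoid u _; set s0 := @sum_n C_AbelianMonoid u N; set t := u _.
  have -> : (s + t - s0 = (s - s0) + t)%C by ring.
  apply: Rle_trans (Cmod_triangle _ _) _.
  by have h := hub (N + k)%coq_nat.+1; rewrite -/t in h; rewrite -/s -/s0 in ih; lra.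
have hbeta k : @sum_n R_AbelianMonoid b k <= beta.
  apply: (is_lim_seq_incr_compare (fun k => @sum_n R_AbelianMonoid b k)) => // n.
  by rewrite sum_Sn /plus /=; move: (Cmod_ge_0 (u n.+1)) (hub n.+1); lra.
apply: le_epsilon => eps heps.
have [M hM'] := proj1 (filterlim_locally_ball_norm _ _) hu (mkposreal _ heps).
have hk := hM' (N + M)%coq_nat ltac:(lia).
have {hk} : Cmod (@sum_n C_AbelianMonoid u (N + M)%coq_nat - f)%C < eps by exact: hk.
move: (hM M) (hbeta (N + M)%coq_nat).
set s := @sum_n C_AbelianMonoid u _; set s0 := @sum_n C_AbelianMonoid u N.
move=> h1 h2 h3.
have -> : (f - s0 = (s - s0) - (s - f))%C by ring.
apply: Rle_trans (Cmod_triangle _ _) _; rewrite Cmod_opp; lra.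
Qed.

Lemma dirichlet_series_correct a s :
  ex_series (fun k => Cmod (dirichlet_term a s k)) ->
  @is_series C_AbsRing C_NormedModule (dirichlet_term a s) (dirichlet_series a s).
Proof.
move=> h.
have [l hl] : @ex_series C_AbsRing C_NormedModule (dirichlet_term a s).
  apply: (@ex_series_le C_AbsRing C_CompleteNormedModule _
            (fun k => Cmod (dirichlet_term a s k))) => // n.
  exact: Rle_refl.
rewrite /dirichlet_series (@iota_filterlim_locally C_AbsRing C_CompleteNormedModule
  _ eventually _ (sum_n (dirichlet_term a s)) l) //.
Qed.

Lemma ln_INR_ge0 n : 0 <= ln (INR n.+1).
Proof.
rewrite -ln_1; apply: Rcomplements.ln_le; first lra.
by rewrite S_INR; move: (pos_INR n); lra.
Qed.

Lemma exp_increasing_le x y : x <= y -> exp x <= exp y.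
Proof. by case=> [/exp_increasing|->]; lra. Qed.

Lemma Cmod_dirichlet_term a s n :
  Cmod (dirichlet_term a s n) = Cmod (a n.+1) * exp (- (Re s * ln (INR n.+1))).
Proof.
rewrite /dirichlet_term Cmod_mult /nat_Cpow_opp Cmod_Cexp; congr (_ * exp _).
by rewrite /Re /Im /=; ring.
Qed.

Lemma dirichlet_term_le a s s' n : Re s' <= Re s ->
  Cmod (dirichlet_term a s n) <= Cmod (dirichlet_term a s' n).
Proof.
move=> h; rewrite !Cmod_dirichlet_term; apply: Rmult_le_compat_l; first exact: Cmod_ge_0.
apply: exp_increasing_le; apply: Ropp_le_contravar; apply: Rmult_le_compat_r => //.
exact: ln_INR_ge0.
Qed.

Lemma exp_neg_INR_ln k x : 0 < x -> exp (- INR k * ln x) = (/ x) ^ k.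
Proof.
move=> hx; rewrite -Rpower_pow; last exact: Rinv_0_lt_compat.
by rewrite /Rpower ln_Rinv //; congr exp; ring.
Qed.

Definition Cpair (x y : R) : C := (x, y).

Definition circle (c r y : R) : C := (c + r * cos y, r * sin y).

(** On the circle s = 1 + e^(iy) / 2 one has m^(-s) = m^(-1) exp (w e^(iy)) with m = n + 1 and w = -
    (ln m) / 2, and the second factor is 2^k e^(-iky). The powers of 2 cancel, leaving the sign
    (-1)^k. The sine integral vanishes, so only the real part of the coefficient survives. *)
Lemma dirichlet_term_integral a n k :
  is_RInt (fun y => Re (dirichlet_term a (circle 1 (/ 2) y) n *
                        Cexp (RtoC (- INR k) * Cpair (ln (/ 2)) y))%C) 0 (2 * PI)
    (2 * PI * (-1) ^ k * (Re (a n.+1) * (ln (INR n.+1) ^ k / INR n.+1 / INR k`!))).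
Proof.
set L := ln (INR n.+1); set w := - / 2 * L.
have hn : 0 < INR n.+1 by rewrite S_INR; move: (pos_INR n); lra.
have hL : exp (- L) = / INR n.+1 by rewrite exp_Ropp /L exp_ln.
pose A := / INR n.+1 * 2 ^ k.
apply: (is_RInt_ext (fun y => (A * Re (a n.+1)) * (exp (w * cos y) * cos (w * sin y - INR k * y)) +
    (- A * Im (a n.+1)) * (exp (w * cos y) * sin (w * sin y - INR k * y)))).
  move=> y _; rewrite /dirichlet_term /nat_Cpow_opp /Cexp -/L /=.
  have e1 : - ((1 + / 2 * cos y) * L - / 2 * sin y * 0) = - L + w * cos y by rewrite /w; ring.
  have e2 : - ((1 + / 2 * cos y) * 0 + / 2 * sin y * L) = w * sin y by rewrite /w; ring.
  have e3 : - INR k * ln (/ 2) - 0 * y = - INR k * ln (/ 2) by ring.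
  have e4 : - INR k * y + 0 * ln (/ 2) = - (INR k * y) by ring.
  rewrite -/(INR k) e1 e2 e3 e4 exp_plus hL exp_neg_INR_ln; last lra.
  rewrite Rinv_inv /A /Rminus cos_plus sin_plus /Re /Im.
  apply: Rminus_diag_uniq; ring.
set v := 2 * PI * _ * _.
have -> : v = (A * Re (a n.+1)) * (2 * PI * (w ^ k / INR k`!)) + (- A * Im (a n.+1)) * 0.
  have -> : w ^ k = (-1) ^ k * (/ 2) ^ k * L ^ k.
    by rewrite -!Rpow_mult_distr; congr (_ ^ _); rewrite /w; ring.
  rewrite /v /A.
  have h2 : 2 ^ k * (/ 2) ^ k = 1 by rewrite -Rpow_mult_distr Rinv_r ?pow1; lra.
  have hf : INR k`! <> 0 by apply: not_0_INR => e; move: (fact_gt0 k); rewrite e.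
  transitivity (2 * PI * (-1) ^ k * (Re (a n.+1) * (L ^ k / INR n.+1 / INR k`!)) * (2 ^ k * (/ 2) ^ k)).
    by rewrite h2; ring.
  by field; lra.
rewrite -[X in _ + _ * X](exp_sin_integral w k) -exp_cos_integral -RInt_linear_comb.
- apply: RInt_correct; apply: (@ex_RInt_plus R_NormedModule);
  apply: (@ex_RInt_scal R_NormedModule); [exact: ex_RInt_exp_cos | exact: ex_RInt_exp_sin].
- exact: ex_RInt_exp_cos.
- exact: ex_RInt_exp_sin.
Qed.

Lemma is_RInt_sum_n (f : nat -> R -> R) (I : nat -> R) a b N :
  (forall n, is_RInt (f n) a b (I n)) ->
  is_RInt (fun y => @sum_n R_AbelianMonoid (fun n => f n y) N) a b (@sum_n R_AbelianMonoid I N).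
Proof.
move=> h; elim: N => [|N ih].
  rewrite sum_O; apply: is_RInt_ext (h 0%N) => y _; by rewrite sum_O.
rewrite sum_Sn; apply: is_RInt_ext (is_RInt_plus _ _ _ _ _ _ ih (h N.+1)) => y _.
by rewrite sum_Sn.
Qed.

Lemma Re_sum_n_mult (u : nat -> C) (z : C) N :
  Re (@sum_n C_AbelianMonoid u N * z)%C = @sum_n R_AbelianMonoid (fun n => Re (u n * z)%C) N.
Proof.
elim: N => [|N ih]; first by rewrite !sum_O.
rewrite !sum_Sn -ih /plus /=.
by rewrite /Re /=; ring.
Qed.

Lemma sum_n_scal (c : R) (u : nat -> R) N :
  @sum_n R_AbelianMonoid (fun n => c * u n) N = c * @sum_n R_AbelianMonoid u N.
Proof.
elim: N => [|N ih]; first by rewrite !sum_O.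
by rewrite !sum_Sn ih /plus /=; ring.
Qed.

(** Put u = e^(x+iy), so |u| <= rho. If Re (1 + u) <= 0 then Re u <= -1, and |1 + u|^2 = 1 + 2 Re u
    + |u|^2 <= rho^2 - 1 < r^2. *)
Lemma near_half_plane_disc x y rho r : 0 < r -> 0 < rho -> exp x <= rho -> rho ^ 2 < 1 + r ^ 2 ->
  0 < Re (1 + Cexp (Cpair x y))%C \/ Cmod (1 + Cexp (Cpair x y))%C < r.
Proof.
move=> hr hrho hx hlt.
have [h|h] := Rlt_le_dec 0 (Re (1 + Cexp (Cpair x y))%C); [by left | right].
apply: Rsqr_incrst_0; try exact: Cmod_ge_0; last lra.
rewrite !Rsqr_pow2 Cmod2_alt; move: h; rewrite /Cexp /Re /Im /=.
move: (sin2_cos2 y) (exp_pos x); rewrite /Rsqr; nra.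
Qed.

(** * Cauchy estimate for the Taylor coefficients at 1 *)

Section TaylorCoefficients.
Variables (a : nat -> C) (r rho : R) (g : C -> C).
Hypotheses (hr : 0 < r) (hrho : 1 < rho) (hlt : rho ^ 2 < 1 + r ^ 2).
Hypothesis hol : holomorphic_on (fun s => 0 < Re s \/ Cmod s < r) g.
Hypothesis hext : forall s : C, 0 < Re s -> g s = dirichlet_series a s.
Hypothesis habs : ex_series (fun n => Cmod (dirichlet_term a (RtoC (/ 2)) n)).

Let G k z := (g (1 + Cexp z) * Cexp (RtoC (- INR k) * z))%C.

Let cdiff_G k x y : x <= ln rho -> cdiff (G k) (Cpair x y).
Proof.
move=> hx; apply: cdiff_mult; last exact: cdiff_Cexp_scal.
apply: (cdiff_comp g (fun z => 1 + Cexp z)%C).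
  apply: (cdiff_comp (fun z => 1 + z)%C); first exact: cdiff_Cexp.
  exact: cdiff_shift.
apply: ex_derive_cdiff; apply: hol.
apply: (near_half_plane_disc x y rho r) => //; first lra.
rewrite -(exp_ln rho); last lra.
exact: exp_increasing_le.
Qed.

(** The Cauchy integral for the k-th Taylor coefficient of [g] at 1 over the circle of radius e^x,
    up to the factor 2 pi and with the real part taken. *)
Let J k x := RInt (fun y => Re (G k (x, y))) 0 (2 * PI).

Let ex_RInt_Re_G k x : x <= ln rho -> ex_RInt (fun y => Re (G k (x, y))) 0 (2 * PI).
Proof.
move=> hx; apply: (@ex_RInt_continuous R_CompleteNormedModule) => y _.
exact: cdiff_continuous_vertical (cdiff_G k x y hx).
Qed.

Let J_eq k : J k (ln rho) = J k (ln (/ 2)).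
Proof.
apply: periodic_strip_integral.
- by apply: Rcomplements.ln_le; lra.
- by case=> x y h; apply: cdiff_G; case: h.
- move=> x; rewrite /G; congr (g _ * _)%C.
    by rewrite /Cexp /= cos_2PI sin_2PI cos_0 sin_0.
  have e t : Cexp (RtoC (- INR k) * (x, t))%C =
      (exp (- INR k * x) * cos (0 - INR k * t), exp (- INR k * x) * sin (0 - INR k * t)).
    rewrite /Cexp /=; congr (exp _ * cos _, exp _ * sin _); ring.
  by rewrite !e cos_sub_period sin_sub_period Rmult_0_r Rminus_0_r.
Qed.

(** The values of [g] on the outer circle. Their integrability is read off from [G 0], whose
    exponential factor is 1. *)
Let F0 y := g (1 + Cexp (Cpair (ln rho) y))%C.

Let ex_RInt_Re_F0 : ex_RInt (fun y => Re (F0 y)) 0 (2 * PI).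
Proof.
apply: ex_RInt_ext (ex_RInt_Re_G 0 (ln rho) (Rle_refl _)) => y _.
rewrite /G /F0 /Cexp /=.
have -> : - 0 * ln rho - 0 * y = 0 by ring.
have -> : - 0 * y + 0 * ln rho = 0 by ring.
by rewrite exp_0 cos_0 sin_0 /Re /= !Rmult_1_l !Rmult_0_r Rminus_0_r Rmult_1_r.
Qed.

Let ex_RInt_Im_F0 : ex_RInt (fun y => Im (F0 y)) 0 (2 * PI).
Proof.
apply: (@ex_RInt_continuous R_CompleteNormedModule) => y _.
have := cdiff_G 0 (ln rho) y (Rle_refl _).
move=> /cdiff_cauchy_riemann [p [q [_ h]]].
have := differentiable_continuous_y _ _ _ _ _ h.
apply: continuous_ext => t.
rewrite /G /F0 /Cexp /=.
have -> : - 0 * ln rho - 0 * t = 0 by ring.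
have -> : - 0 * t + 0 * ln rho = 0 by ring.
by rewrite exp_0 cos_0 sin_0 /Im /= !Rmult_1_l !Rmult_0_r Rplus_0_l Rmult_1_r.
Qed.

(** One constant serves every k: on the outer circle [G k] differs from [F0] by a factor of modulus
    rho^(-k). *)
Let B := RInt (fun y => Rabs (Re (F0 y)) + Rabs (Im (F0 y))) 0 (2 * PI).

Let J_bound k : Rabs (J k (ln rho)) <= B * (/ rho) ^ k.
Proof.
have hpi := PI_RGT_0.
have exB : ex_RInt (fun y => Rabs (Re (F0 y)) + Rabs (Im (F0 y))) 0 (2 * PI).
  apply: (@ex_RInt_plus R_NormedModule); apply: ex_RInt_norm;
    [exact: ex_RInt_Re_F0 | exact: ex_RInt_Im_F0].
have exJ := ex_RInt_Re_G k (ln rho) (Rle_refl _).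
apply: Rle_trans (abs_RInt_le _ _ _ _ exJ) _; first lra.
have -> : B * (/ rho) ^ k =
    RInt (fun y => (/ rho) ^ k * (Rabs (Re (F0 y)) + Rabs (Im (F0 y)))) 0 (2 * PI).
  by rewrite Rmult_comm; symmetry; exact: (RInt_scal _ _ _ _ exB).
apply: RInt_le; first lra.
- exact: ex_RInt_norm exJ.
- exact: (@ex_RInt_scal R_NormedModule).
move=> y _; rewrite /scal /= /mult /= -exp_neg_INR_ln; last lra.
have -> : - INR k * ln rho - 0 * y = - INR k * ln rho by ring.
rewrite -/(Cpair (ln rho) y) -/(F0 y).
set z := F0 y; set e := exp _; set t := _ + 0 * _.
have he : 0 < e by apply: exp_pos.
have -> : z.1 * (e * cos t) - z.2 * (e * sin t) = e * (Re z * cos t - Im z * sin t).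
  by rewrite /Re /Im; ring.
rewrite Rabs_mult (Rabs_pos_eq e); last lra.
apply: Rmult_le_compat_l; first lra.
apply: Rle_trans (Rabs_triang _ _) _; rewrite Rabs_Ropp !Rabs_mult.
have hc : Rabs (cos t) <= 1 by apply: Rabs_le; exact: COS_bound.
have hs : Rabs (sin t) <= 1 by apply: Rabs_le; exact: SIN_bound.
by move: (Rabs_pos (Re z)) (Rabs_pos (Im z)); nra.
Qed.

(** On the circle of radius 1/2 about 1 one has Re s >= 1/2, so the series is dominated by its
    absolute values at 1/2 and may be integrated termwise; this identifies the sum. Moving the
    integral to the circle of radius [rho] bounds it. *)
Lemma taylor_coefficients_bound : exists B : R, forall k, exists L,
  is_series (fun n => Re (a n.+1) * (ln (INR n.+1) ^ k / INR n.+1 / INR k`!)) L /\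
  Rabs L <= B * (/ rho) ^ k.
Proof.
have hpi := PI_RGT_0.
exists (B / (2 * PI)) => k; exists ((-1) ^ k * J k (ln rho) / (2 * PI)); split; last first.
  rewrite /Rdiv !Rabs_mult pow_1_abs Rmult_1_l (Rabs_pos_eq (/ (2 * PI))); last first.
    by apply: Rlt_le; apply: Rinv_0_lt_compat; lra.
  have h := J_bound k.
  have hi : 0 <= / (2 * PI) by apply: Rlt_le; apply: Rinv_0_lt_compat; lra.
  by have := Rmult_le_compat_r _ _ _ hi h; lra.
set u := fun n => _.
have [beta hbeta] := habs.
set b := fun n => Cmod _ in hbeta.
have hs y : 0 < Re (circle 1 (/ 2) y) /\ / 2 <= Re (circle 1 (/ 2) y).
  by rewrite /circle /=; move: (COS_bound y); lra.
have htail y N : Cmod (g (circle 1 (/ 2) y) -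
    @sum_n C_AbelianMonoid (dirichlet_term a (circle 1 (/ 2) y)) N)%C <=
    beta - @sum_n R_AbelianMonoid b N.
  have [h1 h2] := hs y; rewrite hext //.
  have hle n : Cmod (dirichlet_term a (circle 1 (/ 2) y) n) <= b n.
    exact: dirichlet_term_le.
  apply: is_series_tail => //; apply: dirichlet_series_correct.
  apply: (@ex_series_le R_AbsRing R_CompleteNormedModule _ b); last by exists beta.
  by move=> n; rewrite /norm /= /abs /= Rabs_pos_eq; [exact: hle | exact: Cmod_ge_0].
(* On the inner circle the integrands differ by the remainder of the series times a factor of
   modulus 2^k. *)
have hJ N : Rabs (J k (ln (/ 2)) - 2 * PI * (-1) ^ k * @sum_n R_AbelianMonoid u N) <=
    2 * PI * 2 ^ k * (beta - @sum_n R_AbelianMonoid b N).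
  rewrite -sum_n_scal.
  have hI := is_RInt_sum_n _ _ _ _ N (fun n => dirichlet_term_integral a n k).
  rewrite -(is_RInt_unique _ _ _ _ hI) /J.
  have exJ : ex_RInt (fun y => Re (G k (ln (/ 2), y))) 0 (2 * PI).
    by apply: ex_RInt_Re_G; apply: Rcomplements.ln_le; lra.
  have exI := ex_intro _ _ hI; rewrite -/(ex_RInt _ _ _) in exI.
  apply: Rle_trans (Req_le _ _ (f_equal Rabs (esym (RInt_minus _ _ _ _ exJ exI)))) _.
  apply: Rle_trans (_ : _ <= (2 * PI - 0) * (2 ^ k * (beta - @sum_n R_AbelianMonoid b N))) _;
    last by apply: Req_le; ring.
  apply: abs_RInt_le_const; first lra.
    by apply: (@ex_RInt_minus R_NormedModule) => //; exact: exI.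
  have hm (v w : R_NormedModule) : minus v w = Rminus v w by [].
  move=> y _; rewrite hm -Re_sum_n_mult.
  rewrite /G -/(Cpair (ln (/ 2)) y).
  have -> : (1 + Cexp (Cpair (ln (/ 2)) y))%C = circle 1 (/ 2) y.
    rewrite /Cexp /circle /= exp_ln; last lra.
    by rewrite /Cplus /=; congr pair; ring.
  set z := Cexp (_ * _)%C; set s := sum_n _ _; set f := g _.
  have -> : Re (f * z)%C - Re (s * z)%C = Re ((f - s) * z)%C by rewrite /Re /=; ring.
  apply: Rle_trans (re_le_Cmod _) _; rewrite Cmod_mult Rmult_comm.
  have -> : Cmod z = 2 ^ k.
    rewrite /z Cmod_Cexp -[X in _ = X ^ _]Rinv_inv -exp_neg_INR_ln; last lra.
    by congr exp; rewrite /Re /=; ring.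
  by apply: Rmult_le_compat_l; [apply: pow_le; lra | exact: htail].
apply: (proj1 (is_lim_seq_spec (sum_n u) (Rbar.Finite _))) => eps.
have hC : 0 < 2 ^ k by apply: pow_lt; lra.
have heps : 0 < eps / 2 ^ k by apply: Rdiv_lt_0_compat => //; apply: cond_pos.
have [N hN] := proj2 (is_lim_seq_spec (sum_n b) (Rbar.Finite beta)) hbeta (mkposreal _ heps).
exists N => n hn; have := hN n hn; rewrite /=.
move=> /Rabs_lt_between h; have {h} h : beta - @sum_n R_AbelianMonoid b n < eps / 2 ^ k by lra.
have := hJ n; rewrite -J_eq; set s := sum_n u n; set j := J _ _.
move=> h2.
have e1 : (-1) ^ k * (-1) ^ k = 1.
  by rewrite -Rpow_mult_distr; have -> : -1 * -1 = 1 by [ring]; rewrite pow1.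
have -> : s - (-1) ^ k * j / (2 * PI) = - ((-1) ^ k / (2 * PI)) * (j - 2 * PI * (-1) ^ k * s).
  transitivity ((-1) ^ k * (-1) ^ k * s - (-1) ^ k * j / (2 * PI)); first by rewrite e1; ring.
  by field; lra.
rewrite Rabs_mult Rabs_Ropp /Rdiv Rabs_mult pow_1_abs Rmult_1_l (Rabs_pos_eq (/ (2 * PI))); last first.
  by apply: Rlt_le; apply: Rinv_0_lt_compat; lra.
have hp : 0 < 2 * PI by lra.
apply: (Rmult_lt_reg_l (2 * PI)) => //.
rewrite -Rmult_assoc Rinv_r ?Rmult_1_l; last lra.
apply: Rle_lt_trans h2 _; rewrite Rmult_assoc.
apply: Rmult_lt_compat_l => //.
have -> : pos eps = 2 ^ k * (eps / 2 ^ k) by field; lra.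
exact: Rmult_lt_compat_l.
Qed.

End TaylorCoefficients.

(** * Block inequalities *)

Lemma sumR_le I (r : seq I) (F G : I -> R) : (forall i, F i <= G i) ->
  \big[Rplus/0]_(i <- r) F i <= \big[Rplus/0]_(i <- r) G i.
Proof.
move=> h; apply: (big_ind2 Rle) => //; first exact: Rle_refl.
by move=> *; apply: Rplus_le_compat.
Qed.

(** Write [x] as -p + gamma (1, ..., 1) with p in the polar cone; the pairing of p with [beta] is at
    most 0. *)
Lemma cone_duality M (rho gamma : R) (x beta : 'rV[R]_M) :
  set_translate (set_opp (polar_cone (Bcone rho))) (const_mx gamma) x ->
  Bcone rho beta ->
  gamma * \big[Rplus/0]_i beta ord0 i <= \big[Rplus/0]_i (x ord0 i * beta ord0 i).
Proof.
move=> [y [p hp <-] <-] /hp /RleP; rewrite /dot => h.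
have e : \big[Rplus/0]_i ((- p + const_mx gamma)%R ord0 i * beta ord0 i) =
   gamma * (\big[Rplus/0]_i beta ord0 i) - \big[Rplus/0]_i (p ord0 i * beta ord0 i).
  rewrite big_distrr /= /Rminus (big_morph Ropp (op1 := Rplus) (id1 := 0)) //.
  - rewrite -big_split /=; apply: eq_bigr => i _.
    rewrite !mxE; move: (p ord0 i) (beta ord0 i) => s t.
    by rewrite -[LHS]/((- s + gamma) * t); ring.
  - by move=> u v; ring.
  - by ring.
rewrite e.
have {}h : \big[Rplus/0]_i (p ord0 i * beta ord0 i) <= 0 by exact: h.
lra.
Qed.

Lemma block_sum (F : nat -> R) m M :
  \big[Rplus/0]_(m <= n < m + M) F n = \big[Rplus/0]_(i < M) F (m + i)%N.
Proof.
rewrite -{1}[m]add0n big_addn addKn big_mkord.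
by apply: eq_bigr => i _; rewrite addnC.
Qed.

Section Blocks.
Variables (a : nat -> C) (theta : nat -> R) (M : nat) (rho gamma : R).
Hypothesis htheta : forall n : nat, (1 <= n)%N ->
     a n = (RtoC (Cmod (a n)) * Cexp (Ci * RtoC (theta n)))%C.
Hypothesis hrho : 0 < rho.
Hypothesis hgamma : 0 < gamma.
Hypothesis habs : forall l : nat,
     Bcone rho (\row_(i < M) Cmod (a (M * l + i.+1)%N))%R.
Hypothesis hcos : forall l : nat,
     set_translate (set_opp (polar_cone (Bcone rho))) (const_mx gamma)
       (\row_(i < M) cos (theta (M * l + i.+1)%N))%R.

Lemma Re_polar n : Re (a n.+1) = cos (theta n.+1) * Cmod (a n.+1).
Proof.
rewrite {1}(htheta n.+1) // /Cexp /Re /Im /=.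
have -> : 0 * theta n.+1 - 1 * 0 = 0 by ring.
have -> : 0 * 0 + 1 * theta n.+1 = theta n.+1 by ring.
by rewrite exp_0; ring.
Qed.

(** A nonnegative nondecreasing weight preserves the chain of inequalities defining the cone, so the
    weighted moduli lie in it and pair with the cosines. Since Re a_n = |a_n| cos theta_n, the
    pairing is the sum on the right. *)
Lemma block_increasing_weights (u : nat -> R) l :
  (forall n, 0 <= u n) -> (forall n, u n <= u n.+1) ->
  gamma * \big[Rplus/0]_(i < M) (Cmod (a (M * l + i).+1) * u (M * l + i)%N) <=
  \big[Rplus/0]_(i < M) (Re (a (M * l + i).+1) * u (M * l + i)%N).
Proof.
move=> hu0 hu.
pose b (i : 'I_M) := Cmod (a (M * l + i).+1) * u (M * l + i)%N.
pose beta : 'rV[R]_M := (\row_(i < M) b i)%R.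
have hbeta : Bcone rho beta.
  have [h0 h1] := habs l; split=> [i|i j hij].
    rewrite mxE /b; apply/RleP; apply: Rmult_le_pos => //; exact: Cmod_ge_0.
  rewrite !mxE /b hij addnS; have := h1 i j hij; rewrite !mxE hij !addnS.
  move=> /RleP h; apply/RleP; rewrite -!RmultE -!RpowE in h *.
  rewrite -!Rmult_assoc; apply: Rmult_le_compat => //.
  by apply: Rmult_le_pos; [apply: pow_le; lra | exact: Cmod_ge_0].
have := cone_duality _ _ _ _ _ (hcos l) hbeta.
rewrite (eq_bigr (fun i : 'I_M => Cmod (a (M * l + i).+1) * u (M * l + i)%N)); last first.
  by move=> i _; rewrite mxE.
move=> h; apply: Rle_trans h _; apply: Req_le; apply: eq_bigr => i _.
by rewrite !mxE Re_polar addnS /b; ring.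
Qed.

Let w k n := ln (INR n.+1) ^ k / INR n.+1.

(* The comparison weight (ln n)^k / (M l + 1) is nondecreasing on the block, unlike
   (ln n)^k / n itself. *)
Lemma block_weights k l : INR M <= gamma / 2 * INR (M * l).+1 ->
  gamma / 2 * \big[Rplus/0]_(i < M) (Cmod (a (M * l + i).+1) * w k (M * l + i)) <=
  \big[Rplus/0]_(i < M) (Re (a (M * l + i).+1) * w k (M * l + i)).
Proof.
move=> hl.
pose u n := ln (INR n.+1) ^ k.
have hu0 n : 0 <= u n by apply: pow_le; exact: ln_INR_ge0.
have hu n : u n <= u n.+1.
  apply: pow_incr; split; first exact: ln_INR_ge0.
  apply: Rcomplements.ln_le; first by apply: lt_0_INR; lia.
  by rewrite (S_INR n.+1); lra.
have := block_increasing_weights u l hu0 hu.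
have hn0 : 0 < INR (M * l).+1 by apply: lt_0_INR; lia.
set n0 := INR (M * l).+1 in hl hn0 *.
have hi0 : 0 < / n0 by apply: Rinv_0_lt_compat.
set S1 := \big[_/_]_(i < M) _; set S2 := \big[_/_]_(i < M) _ => h.
have hi (i : 'I_M) : n0 <= INR (M * l + i).+1 <= n0 + INR M.
  rewrite /n0 -plus_INR; split; apply: le_INR; apply/leP; first by rewrite ltnS leq_addr.
  by rewrite plusE addSn ltnS leq_add2l ltnW.
(* By [hl] the block is short relative to its first index [n0], so 1/n falls below 1/n0 by at most
   the fraction [gamma / 2]. Replacing 1/n0 by 1/n therefore costs half of [gamma]. *)
have hinv (i : 'I_M) : / INR (M * l + i).+1 <= / n0 /\
    / n0 - / INR (M * l + i).+1 <= gamma / 2 * / n0.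
  have [h1 h2] := hi i; split; first exact: Rinv_le_contravar.
  set n := INR _ in h1 h2 *.
  have hn : 0 < n by lra.
  have -> : / n0 - / n = (n - n0) / n * / n0 by field; lra.
  apply: Rmult_le_compat_r; first lra.
  by apply/Rle_div_l => //; nra.
have b1 : \big[Rplus/0]_(i < M) (Cmod (a (M * l + i).+1) * w k (M * l + i)) <= / n0 * S1.
  rewrite /S1 big_distrr; apply: sumR_le => i /=; rewrite /w -/(u _).
  have h1 := proj1 (hinv i); have h2 := Cmod_ge_0 (a (M * l + i).+1); have h3 := hu0 (M * l + i)%N.
  rewrite /Rdiv -Rmult_assoc (Rmult_comm (/ n0)); apply: Rmult_le_compat_l => //.
  exact: Rmult_le_pos.
have b2 : / n0 * S2 <= \big[Rplus/0]_(i < M) (Re (a (M * l + i).+1) * w k (M * l + i)) +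
    gamma / 2 * / n0 * S1.
  rewrite /S1 /S2 !big_distrr /= -big_split /=; apply: sumR_le => i; rewrite /w -/(u _) [X in _ <= _ * X + _]/Rdiv.
  have h1 := hinv i; have h2 := re_le_Cmod (a (M * l + i).+1); have h3 := hu0 (M * l + i)%N.
  set z := Re _ in h2 *; set c := Cmod _ in h2 *; set v := u _ in h3 *; set m := / INR _ in h1 *.
  have h4 : z * v * (/ n0 - m) <= c * v * (gamma / 2 * / n0).
    have hz : z <= c by move: (Rle_abs z); lra.
    have hc : 0 <= c by move: (Rabs_pos z); lra.
    apply: Rle_trans (_ : c * v * (/ n0 - m) <= _).
      by apply: Rmult_le_compat_r; [lra | apply: Rmult_le_compat_r].
    by apply: Rmult_le_compat_l; [apply: Rmult_le_pos | lra].
  by lra.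
have h5 := Rmult_le_compat_l _ _ _ (Rlt_le _ _ hi0) h.
have h6 := Rmult_le_compat_l (gamma / 2) _ _ ltac:(lra) b1.
lra.
Qed.

Lemma sum_blocks_weights : exists l0, forall k l,
  gamma / 2 * \big[Rplus/0]_(M * l0 <= n < M * (l0 + l)) (Cmod (a n.+1) * w k n) <=
  \big[Rplus/0]_(M * l0 <= n < M * (l0 + l)) (Re (a n.+1) * w k n).
Proof.
(* From [l0 * (gamma / 2) > 1] every block from [l0] on is short enough. The choice does not depend
   on [k], as the later summation over [k] requires. *)
have [l0 hl0] := INR_archimed (gamma / 2) 1 ltac:(lra).
exists l0 => k; elim=> [|l ih].
  by rewrite addn0 !big_geq //; lra.
have hcat F : \big[Rplus/0]_(M * l0 <= n < M * (l0 + l.+1)) F n =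
   \big[Rplus/0]_(M * l0 <= n < M * (l0 + l)) F n +
   \big[Rplus/0]_(i < M) F (M * (l0 + l) + i)%N.
  rewrite -block_sum -mulnSr -addnS (big_cat_nat (n := (M * (l0 + l))%N)) //=.
    by rewrite leq_mul2l leq_addr orbT.
  by rewrite leq_mul2l addnS leqnSn orbT.
rewrite !hcat Rmult_plus_distr_l; apply: Rplus_le_compat => //.
apply: block_weights; rewrite S_INR mulnE mult_INR -plusE plus_INR.
move: (pos_INR M) (pos_INR l) => h1 h2.
apply: Rle_trans (_ : INR M * (gamma / 2 * INR l0) <= _); first by nra.
have h3 := Rmult_le_pos _ _ (Rlt_le _ _ hgamma) (Rmult_le_pos _ _ h1 h2).
by lra.
Qed.

End Blocks.

(** * Summation over the Taylor coefficients *)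

Lemma sumR_ge0 I (r : seq I) (F : I -> R) : (forall i, 0 <= F i) ->
  0 <= \big[Rplus/0]_(i <- r) F i.
Proof.
move=> h; apply: (big_ind (Rle 0)) => //; first exact: Rle_refl.
exact: Rplus_le_le_0_compat.
Qed.

Lemma sum_n_big (F : nat -> R) N :
  @sum_n R_AbelianMonoid F N = \big[Rplus/0]_(0 <= n < N.+1) F n.
Proof.
elim: N => [|N ih]; first by rewrite sum_O big_nat1.
by rewrite sum_Sn ih [in RHS]big_nat_recr.
Qed.

Lemma is_series_big I (r : seq I) (F : nat -> I -> R) (S : I -> R) :
  (forall i, is_series (fun k => F k i) (S i)) ->
  is_series (fun k => \big[Rplus/0]_(i <- r) F k i) (\big[Rplus/0]_(i <- r) S i).
Proof.
move=> h; elim: r => [|i r ih]; last first.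
  rewrite big_cons; apply: is_series_ext (is_series_plus _ _ _ _ (h i) ih) => k.
  by rewrite big_cons.
rewrite big_nil; apply: is_series_ext (_ : is_series (fun=> 0) 0) => [k|].
  by rewrite big_nil.
apply: (filterlim_ext (fun=> 0)); last exact: filterlim_const.
by elim=> [|n ih]; rewrite ?sum_O ?sum_Sn -?ih // /plus /= Rplus_0_l.
Qed.

Lemma is_lim_seq_big (F : nat -> R) (l : R) (phi : nat -> nat) :
  is_series F l -> (forall n, (phi n < phi n.+1)%N) ->
  is_lim_seq (fun j => \big[Rplus/0]_(0 <= n < phi j) F n) l.
Proof.
move=> h hphi.
apply: (is_lim_seq_subseq (fun N => \big[Rplus/0]_(0 <= n < N) F n)).
  by apply: eventually_subseq => n; apply/ltP.
(* [sum_n F N] includes the term of index [N], so it equals the sum over indices below [N + 1]. *)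
apply/is_lim_seq_incr_1; apply: is_lim_seq_ext (_ : is_lim_seq (sum_n F) l) => // N.
exact: sum_n_big.
Qed.

Lemma exp_series x : is_series (fun k => x ^ k / INR k`!) (exp x).
Proof.
apply: is_series_ext (is_exp_Reals x) => k.
by rewrite /scal /= /mult /= pow_n_pow factE.
Qed.

Section Summation.
Variables (a : nat -> C) (M l0 : nat) (gamma rho q B : R).
Hypotheses (hM : (0 < M)%N) (hgamma : 0 < gamma) (hq : 1 < q) (hqrho : q < rho).
Let w k n := ln (INR n.+1) ^ k / INR n.+1.
Hypothesis htaylor : forall k, exists L,
  is_series (fun n => Re (a n.+1) * (ln (INR n.+1) ^ k / INR n.+1 / INR k`!)) L /\
  Rabs L <= B * (/ rho) ^ k.
Hypothesis hblocks : forall k l,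
  gamma / 2 * \big[Rplus/0]_(M * l0 <= n < M * (l0 + l)) (Cmod (a n.+1) * w k n) <=
  \big[Rplus/0]_(M * l0 <= n < M * (l0 + l)) (Re (a n.+1) * w k n).

Let c k n := Cmod (a n.+1) * (w k n / INR k`!).
Let x k n := Re (a n.+1) * (w k n / INR k`!).

Let INR_fact_gt0 k : 0 < INR k`!.
Proof. by apply: lt_0_INR; apply/ltP; exact: fact_gt0. Qed.

Let INR_S_gt0 n : 0 < INR n.+1.
Proof. by rewrite S_INR; move: (pos_INR n); lra. Qed.

Let w_ge0 k n : 0 <= w k n / INR k`!.
Proof.
apply: Rdiv_le_0_compat => //; apply: Rdiv_le_0_compat => //.
by apply: pow_le; exact: ln_INR_ge0.
Qed.

Let c_ge0 k n : 0 <= c k n.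
Proof. by apply: Rmult_le_pos => //; exact: Cmod_ge_0. Qed.

Let blocks k l :
  gamma / 2 * \big[Rplus/0]_(M * l0 <= n < M * (l0 + l)) c k n <=
  \big[Rplus/0]_(M * l0 <= n < M * (l0 + l)) x k n.
Proof.
have e u : \big[Rplus/0]_(M * l0 <= n < M * (l0 + l)) (u n * (w k n / INR k`!)) =
   / INR k`! * \big[Rplus/0]_(M * l0 <= n < M * (l0 + l)) (u n * w k n).
  rewrite big_distrr; apply: eq_bigr => n _ /=; rewrite /Rdiv; ring.
rewrite /c /x !e; have := hblocks k l.
set S := \big[_/_]_(_ <= _ < _) _; set S' := \big[_/_]_(_ <= _ < _) _ => h.
have hi : 0 < / INR k`! by apply: Rinv_0_lt_compat.
by have := Rmult_le_compat_l _ _ _ (Rlt_le _ _ hi) h; lra.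
Qed.

(** Split the Taylor series at index [M * l0]. The early terms are at least minus their moduli, the
    later blocks satisfy the block inequality, and cutting at block ends gives the limit [L]. *)
Let coefficient_bound k l :
  gamma / 2 * \big[Rplus/0]_(M * l0 <= n < M * (l0 + l)) c k n <=
  B * (/ rho) ^ k + \big[Rplus/0]_(0 <= n < M * l0) c k n.
Proof.
have [L [hL hLB]] := htaylor k.
suff : gamma / 2 * \big[Rplus/0]_(M * l0 <= n < M * (l0 + l)) c k n -
    \big[Rplus/0]_(0 <= n < M * l0) c k n <= L.
  by move: (Rle_abs L); lra.
have hlim := is_lim_seq_big (x k) L (fun j => (M * (l0 + j))%N) hL.
have {}hlim := hlim ltac:(by move=> j; rewrite ltn_pmul2l // addnS).
apply: (is_lim_seq_le_loc (fun=> _) _ _ _ _ (is_lim_seq_const _) hlim).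
exists l => j /leP hj.
have hcat F : \big[Rplus/0]_(0 <= n < M * (l0 + j)) F n =
    \big[Rplus/0]_(0 <= n < M * l0) F n + \big[Rplus/0]_(M * l0 <= n < M * (l0 + j)) F n.
  by rewrite (big_cat_nat (n := (M * l0)%N)) //= leq_mul2l leq_addr orbT.
have hmono : \big[Rplus/0]_(M * l0 <= n < M * (l0 + l)) c k n <=
    \big[Rplus/0]_(M * l0 <= n < M * (l0 + j)) c k n.
  rewrite [X in _ <= X](big_cat_nat (n := (M * (l0 + l))%N)) /=.
  - have := sumR_ge0 _ (index_iota (M * (l0 + l)) (M * (l0 + j))) _ (c_ge0 k).
    set S := \big[_/_]_(_ <- _) _; lra.
  - by rewrite leq_mul2l leq_addr orbT.
  - by rewrite leq_mul2l leq_add2l hj orbT.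
rewrite hcat; move: (blocks k j).
have hneg : 0 <= \big[Rplus/0]_(0 <= n < M * l0) x k n +
    \big[Rplus/0]_(0 <= n < M * l0) c k n.
  rewrite -big_split; apply: sumR_ge0 => n /=; rewrite /x /c -Rmult_plus_distr_r.
  apply: Rmult_le_pos => //; move: (re_le_Cmod (a n.+1)).
  by move/Rabs_le_between; lra.
have := Rmult_le_compat_l (gamma / 2) _ _ ltac:(lra) hmono.
lra.
Qed.

(** This is |a_m| m^(q-1) with m = n + 1, the exponential sum over k of [q ^ k * c k n]. *)
Let T n := Cmod (a n.+1) * (exp (q * ln (INR n.+1)) / INR n.+1).

Let series_T n : is_series (fun k => q ^ k * c k n) (T n).
Proof.
have := is_series_scal_l (Cmod (a n.+1) / INR n.+1) _ _ (exp_series (q * ln (INR n.+1))).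
have -> : T n = Cmod (a n.+1) / INR n.+1 * exp (q * ln (INR n.+1)).
  by rewrite /T /Rdiv; ring.
apply: is_series_ext => k.
rewrite /c /w /scal /= /mult /= Rpow_mult_distr; apply: Rminus_diag_uniq; field.
by split; apply: Rgt_not_eq; [exact: INR_S_gt0 | exact: INR_fact_gt0].
Qed.

(** Multiply the coefficient bound by [q ^ k] and sum over k; the first term becomes a geometric
    series of ratio q / rho < 1. Only finite sums over n are exchanged with the series over k, and
    the bound is independent of [l]. *)
Let tail_bound l :
  gamma / 2 * \big[Rplus/0]_(M * l0 <= n < M * (l0 + l)) T n <=
  B * / (1 - q / rho) + \big[Rplus/0]_(0 <= n < M * l0) T n.
Proof.
have hr : Rabs (q / rho) < 1.
  rewrite Rabs_pos_eq; last by apply: Rdiv_le_0_compat; lra.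
  by apply/Rlt_div_l; lra.
pose F k := gamma / 2 * \big[Rplus/0]_(M * l0 <= n < M * (l0 + l)) (q ^ k * c k n).
pose G k := B * (q / rho) ^ k + \big[Rplus/0]_(0 <= n < M * l0) (q ^ k * c k n).
have hF : is_series F (gamma / 2 * \big[Rplus/0]_(M * l0 <= n < M * (l0 + l)) T n).
  exact: is_series_scal_l (is_series_big _ _ _ _ series_T).
have hG : is_series G (B * / (1 - q / rho) + \big[Rplus/0]_(0 <= n < M * l0) T n).
  apply: is_series_plus (is_series_big _ _ _ _ series_T).
  exact: is_series_scal_l (is_series_geom _ hr).
rewrite -(is_series_unique _ _ hF) -(is_series_unique _ _ hG).
apply: Series_le; last by eexists; exact: hG.
rewrite /F /G => k.
have hk : 0 < q ^ k by apply: pow_lt; lra.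
rewrite -!(big_distrr (times := Rmult)) /=; split.
  apply: Rmult_le_pos; first lra.
  by apply: Rmult_le_pos; [lra | apply: sumR_ge0].
have := Rmult_le_compat_l _ _ _ (Rlt_le _ _ hk) (coefficient_bound k l).
rewrite /Rdiv Rpow_mult_distr; lra.
Qed.

(** For Re s > 1 - q the terms are dominated by [T], whose partial sums are bounded: they are at
    most the early part plus 2 / gamma times the tail bound. *)
Lemma ex_series_left_of_zero (s : C) : 1 - q < Re s ->
  ex_series (fun n => Cmod (dirichlet_term a s n)).
Proof.
move=> hs.
have T_ge0 n : 0 <= T n.
  apply: Rmult_le_pos; first exact: Cmod_ge_0.
  by apply: Rdiv_le_0_compat => //; apply: Rlt_le; exact: exp_pos.
apply: (@ex_series_le R_AbsRing R_CompleteNormedModule _ T) => [n|].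
  rewrite /norm /= /abs /= Rabs_pos_eq; last exact: Cmod_ge_0.
  rewrite Cmod_dirichlet_term /T; apply: Rmult_le_compat_l; first exact: Cmod_ge_0.
  have -> : exp (q * ln (INR n.+1)) / INR n.+1 = exp ((q - 1) * ln (INR n.+1)).
    rewrite -{2}(exp_ln (INR n.+1)) // /Rdiv -exp_Ropp -exp_plus.
    by congr exp; ring.
  by apply: exp_increasing_le; move: (ln_INR_ge0 n); nra.
set D := B * / (1 - q / rho) + \big[Rplus/0]_(0 <= n < M * l0) T n.
have [l hl] : ex_finite_lim_seq (fun N => @sum_n R_AbelianMonoid T N).
  apply: (ex_finite_lim_seq_incr _ (\big[Rplus/0]_(0 <= n < M * l0) T n + 2 / gamma * D)) => N.
    by rewrite sum_Sn /plus /=; move: (T_ge0 N.+1); lra.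
  rewrite sum_n_big.
  have h1 := tail_bound N.+1.
  have h2 : \big[Rplus/0]_(0 <= n < N.+1) T n <= \big[Rplus/0]_(0 <= n < M * (l0 + N.+1)) T n.
    rewrite [X in _ <= X](big_cat_nat (n := N.+1)) //=.
      have := sumR_ge0 _ (index_iota N.+1 (M * (l0 + N.+1))) _ T_ge0.
      by set S := \big[_/_]_(_ <- _) _; lra.
    (* Since [M >= 1], the first N + 1 indices all precede the end of block number l0 + N. *)
    by apply: leq_trans (leq_pmull _ hM); apply: leq_addl.
  apply: Rle_trans h2 _.
  rewrite (big_cat_nat (n := (M * l0)%N)) //=; last by rewrite leq_mul2l leq_addr orbT.
  apply: Rplus_le_compat_l.
  move: h1; rewrite -/D; set S := \big[_/_]_(_ <= _ < _) _ => h1.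
  have -> : S = 2 / gamma * (gamma / 2 * S) by field; lra.
  by apply: Rmult_le_compat_l => //; apply: Rlt_le; apply: Rdiv_lt_0_compat; lra.
by exists l.
Qed.

End Summation.

(** * Choice of radii and contradiction with the abscissa *)

Theorem theorem3 (a : nat -> C) (theta : nat -> R) (M : nat) (rho gamma : R)
  (hsigma : abscissa_abs_conv a = Rbar.Finite 0)
  (htheta : forall n : nat, (1 <= n)%N ->
     a n = (RtoC (Cmod (a n)) * Cexp (Ci * RtoC (theta n)))%C)
  (hM : (1 <= M)%N)
  (hrho : 0 < rho)
  (hgamma : 0 < gamma)
  (habs : forall l : nat,
     Bcone rho (\row_(i < M) Cmod (a (M * l + i.+1)%N))%R)
  (hcos : forall l : nat,
     set_translate (set_opp (polar_cone (Bcone rho))) (const_mx gamma)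
       (\row_(i < M) cos (theta (M * l + i.+1)%N))%R) :
  ~ has_holomorphic_extension_near_0 (dirichlet_series a).
Proof.
move=> [r [g [hr [hol hext]]]].
have [hlb hglb] := Glb_Rbar_correct (fun sigma : R => forall s : C, sigma < Re s ->
  ex_series (fun k => Cmod (dirichlet_term a s k))).
rewrite -/(abscissa_abs_conv a) hsigma in hlb hglb.
have hconv : ex_series (fun n => Cmod (dirichlet_term a (RtoC (/ 2)) n)).
  (* If absolute convergence failed at 1/2, no sigma < 1/2 would be admissible, and the infimum
     would be at least 1/2. *)
  apply: NNPP => hn; suff : Rbar_le (Rbar.Finite (/ 2)) (Rbar.Finite 0) by move=> /=; lra.
  apply: hglb => sigma hs /=; apply: Rnot_lt_le => hlt.
  by apply: hn; apply: hs.
(* The outer radius is 1 + d, distinct from the cone parameter [rho]: (1 + d)^2 <= 1 + 3d < 1 + r^2.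
   The exponent q = 1 + d/2 lies strictly between 1 and this radius. *)
pose d := Rmin 1 (r ^ 2 / 4).
have hr2 : 0 < r ^ 2 by apply: pow_lt.
have hd : 0 < d by apply: Rmin_pos; lra.
have hd1 : d <= 1 by apply: Rmin_l.
have hd2 : d <= r ^ 2 / 4 by apply: Rmin_r.
have [B hB] := taylor_coefficients_bound a r (1 + d) g hr ltac:(lra) ltac:(nra) hol hext hconv.
have [l0 hl0] := sum_blocks_weights a theta M rho gamma htheta hrho hgamma habs hcos.
(* Absolute convergence holds for Re s > -d/2, so the infimum 0 would be at most -d/2. *)
have /= := hlb (1 - (1 + d / 2)) (ex_series_left_of_zero a M l0 gamma (1 + d) (1 + d / 2) B
  hM hgamma ltac:(lra) ltac:(lra) hB hl0).
lra.
Qed.
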